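(* Let $d\ge 1$ and let $E\subset\mathbb{R}^d$ be closed. For any moment order $k>0$ and any exponent $0<\gamma<(d+1+d/k)^{-1}$, there exists a constant $C=C(d,k,\gamma)\in(0,\infty)$ such that for any $f\in\mathbf{P}(E)$, any $N\ge 1$, any $G^N\in\mathbf{P}_{sym}(E^N)$, and any $j,\ell\in\{1,\dots,N\}\cup\{\infty\}$ with $\ell\neq 1$, there holds $$\Omega_j(G^N;f)\le C\,\mathscr{M}_k^{1/k}\Big(\Omega_\ell(G^N;f)+\frac1N\Big)^{\gamma},$$ where $\mathscr{M}_k:=M_k(f)+M_k(G^N_1)$.
   Context: $\mathbf{P}(Z)$ is the set of Borel probability measures on $Z$; $\mathbf{P}_{sym}(E^N)$ is the set of probability measures on $E^N$ invariant under permutations of the $N$ coordinates. For $G^N\in\mathbf{P}_{sym}(E^N)$ and $1\le j\le N$, $G^N_j\in\mathbf{P}(E^j)$ is the marginal of $G^N$ on the first $j$ coordinates. $M_k(\rho):=\int_E\langle v\rangle^k\rho(dv)$ with $\langle v\rangle:=\sqrt{1+|v|^2}$ (possibly $+\infty$). Distances: $d_E(x,y):=\min(|x-y|,1)$ on $E$; $d_{E^j}(X,Y):=\frac1j\sum_{i=1}^j d_E(x_i,y_i)$ on $E^j$. $W_1$ denotes the Monge-Kantorovich-Wasserstein distance on $\mathbf{P}(E^j)$ with cost $d_{E^j}$: $W_1(F,G):=\inf_\pi\int d_{E^j}(X,Y)\,\pi(dX,dY)$, the infimum being over all $\pi\in\mathbf{P}(E^j\times E^j)$ with marginals $F$ and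 $G$. For $X=(x_1,\dots,x_N)\in E^N$, $\mu^N_X:=\frac1N\sum_{i=1}^N\delta_{x_i}\in\mathbf{P}(E)$. Measures of chaos: for $1\le j\le N$, $\Omega_j(G^N;f):=W_1(G^N_j,f^{\otimes j})$, and $\Omega_\infty(G^N;f):=\int_{E^N}W_1(\mu^N_X,f)\,G^N(dX)$. *)

(* Defs.v *)
From HB Require Import structures.
From mathcomp Require Import all_boot all_order all_algebra fingroup perm.
From mathcomp Require Import all_classical all_reals all_analysis.

Set Implicit Arguments.
Unset Strict Implicit.
Unset Printing Implicit Defensive.
Import Order.TTheory GRing.Theory Num.Theory.
Import numFieldNormedType.Exports.

Local Open Scope classical_set_scope.
Local Open Scope ring_scope.

(* R^d with its Borel sigma-algebra.  The library norm on row vectors is the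
   sup norm (same topology), hence the separate Euclidean norm.  Tuples of
   points of R^d carry the product sigma-algebra, which is the Borel one. *)
Definition Rd (R : realType) (d : nat) : measurableType _ :=
  g_sigma_algebraType (@open 'rV[R]_d).

Definition enorm (R : realType) (d : nat) (v : 'rV[R]_d) : R :=
  Num.sqrt (\sum_(i < d) v ord0 i ^+ 2).

Definition japanese (R : realType) (d : nat) (v : 'rV[R]_d) : R :=
  Num.sqrt (1 + enorm v ^+ 2).

Definition dE (R : realType) (d : nat) (x y : 'rV[R]_d) : R :=
  Num.min (enorm (x - y)) 1.

Definition dEj (R : realType) (d j : nat) (X Y : j.-tuple (Rd R d)) : R :=
  j%:R^-1 * \sum_(i < j) dE (tnth X i) (tnth Y i).

(* P(E), for E closed, is encoded as the Borel probability measures on R^d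
   carried by E, and P(E^j) as the probability measures on (R^d)^j carried by
   E^j.  A coupling of two measures carried by A is itself carried by A x A,
   so the couplings below need not mention E, and neither do the integrals. *)
Definition prob_on (R : realType) (d : nat) (E : set 'rV[R]_d)
    (f : probability (Rd R d) R) : Prop :=
  f E = 1%E.

Definition cart_power (T : Type) (E : set T) (N : nat) : set (N.-tuple T) :=
  [set X | forall i, E (tnth X i)].

Definition permute (T : Type) (N : nat) (s : {perm 'I_N}) (X : N.-tuple T) :
    N.-tuple T :=
  [tuple tnth X (s i) | i < N].

Definition sym_prob_on (R : realType) (d : nat) (E : set 'rV[R]_d) (N : nat)
    (G : probability (N.-tuple (Rd R d)) R) : Prop :=
  G (@cart_power (Rd R d) E N) = 1%E /\
  forall (s : {perm 'I_N}) (A : set (N.-tuple (Rd R d))),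
    measurable A -> G (permute s @^-1` A) = G A.

Section transport.
Local Open Scope ereal_scope.
Context (disp : measure_display) (T : measurableType disp) (R : realType).

Definition coupling (F G : {measure set T -> \bar R}) :
    set (probability (T * T)%type R) :=
  [set p | (forall A, measurable A -> p (A `*` setT) = F A) /\
           (forall B, measurable B -> p (setT `*` B) = G B)].

Definition W1 (c : T -> T -> R) (F G : {measure set T -> \bar R}) : \bar R :=
  ereal_inf [set \int[p]_z (c z.1 z.2)%:E | p in coupling F G].

End transport.

Section tuples.
Context (disp : measure_display) (T : measurableType disp) (R : realType).

(* The first j coordinates; [point] is only reached when N < j. *)
Definition first_coords (N j : nat) (X : N.-tuple T) : j.-tuple T :=
  [tuple nth point X i | i < j].

Lemma measurable_first_coords (N j : nat) :
  measurable_fun setT (@first_coords N j).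
Proof.
apply/measurable_fun_tnthP => i.
have [iN|Ni] := ltnP i N.
  rewrite (_ : _ \o _ = fun X : N.-tuple T => tnth X (Ordinal iN)).
    exact: measurable_tnth.
  by apply/funext => X /=; rewrite tnth_mktuple (tnth_nth point).
rewrite (_ : _ \o _ = cst point); first exact: measurable_cst.
by apply/funext => X /=; rewrite tnth_mktuple nth_default// size_tuple.
Qed.

HB.instance Definition _ (N j : nat) :=
  isMeasurableFun.Build _ _ _ _ (@first_coords N j)
    (@measurable_first_coords N j).

Definition marginal (N : nat) (G : probability (N.-tuple T) R) (j : nat) :
    probability (j.-tuple T) R :=
  distribution G (@first_coords N j).

(* Identifies P(T^1) with P(T). *)
Definition thead1 (X : 1.-tuple T) : T := thead X.

Lemma measurable_thead1 : measurable_fun setT thead1.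
Proof. exact: measurable_tnth. Qed.

HB.instance Definition _ :=
  isMeasurableFun.Build _ _ _ _ thead1 measurable_thead1.

Definition untuple1 (P : probability (1.-tuple T) R) : probability T R :=
  distribution P thead1.

Definition tcons (n : nat) (z : T * n.-tuple T) : n.+1.-tuple T :=
  [tuple of z.1 :: z.2].

Lemma measurable_tcons (n : nat) : measurable_fun setT (@tcons n).
Proof. exact: measurable_cons. Qed.

HB.instance Definition _ (n : nat) :=
  isMeasurableFun.Build _ _ _ _ (@tcons n) (@measurable_tcons n).

Fixpoint tensor_power (f : probability T R) (n : nat) :
    probability (n.-tuple T) R :=
  if n is m.+1 then
    distribution (f \x tensor_power f m)%E (@tcons m)
  else dirac [tuple].

(* [point] is never reached, the sum being over i < N; used only for 0 < N. *)
Definition empirical (N : nat) (X : N.-tuple T) : {measure set T -> \bar R} :=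
  mscale (N%:R^-1)%:nng (msum (fun i => dirac (nth point X i)) N).

End tuples.

Definition moment (R : realType) (d : nat) (k : R)
    (rho : probability (Rd R d) R) : \bar R :=
  (\int[rho]_v (japanese v `^ k)%:E)%E.

Definition Omega_fin (R : realType) (d N : nat)
    (G : probability (N.-tuple (Rd R d)) R) (f : probability (Rd R d) R)
    (j : nat) : \bar R :=
  W1 (@dEj R d j) (marginal G j) (tensor_power f j).

Definition Omega_infty (R : realType) (d N : nat)
    (G : probability (N.-tuple (Rd R d)) R) (f : probability (Rd R d) R) :
    \bar R :=
  (\int[G]_X W1 (@dE R d : Rd R d -> Rd R d -> R) (empirical R X) f)%E.

(* Indices of measures of chaos range over {1, ..., N} together with infinity,
   the latter encoded as [None]. *)
Definition chaos_index (N : nat) (j : option nat) : Prop :=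
  if j is Some m then (1 <= m <= N)%N else True.

Definition Omega (R : realType) (d N : nat)
    (G : probability (N.-tuple (Rd R d)) R) (f : probability (Rd R d) R)
    (j : option nat) : \bar R :=
  if j is Some m then Omega_fin G f m else Omega_infty G f.

Definition moment_sum (R : realType) (d N : nat) (k : R)
    (f : probability (Rd R d) R) (G : probability (N.-tuple (Rd R d)) R) :
    \bar R :=
  (moment k f + moment k (untuple1 (marginal G 1)))%E.

(* Main.v *)
Require Import Defs.
From HB Require Import structures.
From mathcomp Require Import all_boot all_order all_algebra fingroup perm.
From mathcomp Require Import all_classical all_reals all_analysis.
From mathcomp Require Import measurable_realfun ring lra zify.
Import Order.TTheory GRing.Theory Num.Theory.
Import numFieldNormedType.Exports.

(** Each Omega_j is bounded from above by multiscale differences of cell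
frequencies, and these are bounded from above by any Omega_l with l <> 1. All
measures are observed through finite codes, so that the argument is about finite
sums.

Upper bound. Cut R^d into cubes of side 2^-n for n = 0, ..., L, nested and
wrapped on a torus so that they are finitely many, and translate them all by a
common shift. Let X have law G and let Y be an independent sample of N points of
law f. A single permutation sigma makes, in every cell Q of every level, the
number of pairs (x_i, y_sigma(i)) separated by Q at most the difference of the
numbers of points of X and Y in Q ([mismatches_best_matching]), so that
  1/N sum_i dE(x_i, y_sigma(i)) <=
    d 2^-L + sum_n 2d 2^-n sum_Q |mu_X(Q) - mu_Y(Q)| + (points out of the box).
The matched pairs, reordered by a uniform random permutation, form a transport
plan for Omega_j for all finite j at once, and, averaged over Y only, for
Omega_infty ([Omega_le_matching]). Young's inequality bounds the sum over the
cells of a level by lam #cells + (1/lam) sum_Q (mu_X(Q) - f(Q))^2, up to the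
similar term in Y; the sum of squares is called the discrepancy.

Lower bound. The mean discrepancy involves only the law of pairs of particles,
and it is O(1/N) for independent particles. Under a coupling of the measures
compared in Omega_l, it changes only when two coupled points x, y are separated by the boundary of a
cell, which for a random shift has probability at most of order 2^n |x - y|
([shifts_separating]). Hence at level n the mean discrepancy over the shifts is
O(2^n (Omega_l + 1/N)) ([mean_discrepancy_le_Omega]). The shifts are multiples
of 2^-L / N; this discretisation adds an error of order 2^n / N only.

Conclusion. With A = Omega_l + 1/N and 2r + 1 the side of the torus, this gives
for all L, r and lam ([Omega_le_multiscale])
  Omega_j <= C (2^-L + (L + 1) (r^d 2^(L(d-1)) lam + A / lam) + M_k r^-k),
and it remains to optimise ([optimal_scale]): taking 2^-L of order
eta = M_k^(1/k) A^gamma and r^k of order M_k / eta, all the terms are of order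
eta if (L + 1)^2 M_k^(d/k) A is at most of order eta^(d + 1 + d/k). The exponent
1 / (d + 1 + d/k) is the one at which the powers of A balance; the factor
(L + 1)^2 is logarithmic in A and is absorbed when gamma is strictly smaller. *)

Local Open Scope classical_set_scope.
Local Open Scope ring_scope.

Set Implicit Arguments.
Unset Strict Implicit.
Unset Printing Implicit Defensive.

(** * Finite-valued observables and their laws *)

Section finite_codes.
Context (disp : measure_display) (S : measurableType disp) (R : realType).

Definition coded (F : finType) (h : S -> F) :=
  forall v, measurable (h @^-1` [set v]).

Lemma codedP (F : finType) (h : S -> F) (B : set F) :
  coded h -> measurable (h @^-1` B).
Proof.
move=> mh; have -> : h @^-1` B = \bigcup_(v in B) (h @^-1` [set v]).
  by apply/seteqP; split => [x Bx|x [v Bv /= ->]//]; exists (h x).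
by apply: fin_bigcup_measurable; [exact: finite_finset|move=> *; exact: mh].
Qed.

Lemma coded_comp (F F' : finType) (h : S -> F) (g : F -> F') :
  coded h -> coded (g \o h).
Proof. by move=> mh v; exact: (codedP [set a | g a = v] mh). Qed.

Lemma coded_pair (F F' : finType) (h : S -> F) (h' : S -> F') :
  coded h -> coded h' -> coded (fun x => (h x, h' x)).
Proof.
move=> mh mh' [v v'].
rewrite (_ : _ @^-1` _ = h @^-1` [set v] `&` h' @^-1` [set v']).
  exact: measurableI.
by apply/seteqP; split => x /= => [[]|[-> ->]].
Qed.

Lemma coded_ffun (I F : finType) (h : I -> S -> F) :
  (forall i, coded (h i)) -> coded (fun x => [ffun i => h i x]).
Proof.
move=> mh v.
rewrite (_ : _ @^-1` _ = \bigcap_(i in [set: I]) (h i @^-1` [set v i])).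
  by apply: fin_bigcap_measurable; [exact: finite_finset|move=> i _; exact: mh].
apply/seteqP; split => x /=.
  by move=> <- i _ /=; rewrite ffunE.
by move=> H; apply/ffunP => i; rewrite ffunE; exact: H.
Qed.

(** The measure is a bare set function so that [law] applies alike to
probabilities and to empirical measures. *)
Definition law (P : set S -> \bar R) (F : finType) (h : S -> F) (v : F) : R :=
  fine (P (h @^-1` [set v])).

Lemma integral_coded (P : {measure set S -> \bar R}) (F : finType)
    (h : S -> F) (u : F -> R) : coded h -> P setT = 1%E ->
  (forall v, 0 <= u v) ->
  (\int[P]_x (u (h x))%:E = (\sum_v law P h v * u v)%:E)%E.
Proof.
move=> mh P1 u0.
under eq_integral => x _.
  rewrite (_ : (u (h x))%:E =
      \sum_(v : F) (u v)%:E * (\1_(h @^-1` [set v]) x)%:E)%E; last first.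
    rewrite (bigD1 (h x))//= big1 ?adde0.
      by rewrite indicE mem_set// mule1.
    by move=> v vh; rewrite indicE memNset ?mule0//= => /esym/eqP; apply/negP.
  over.
rewrite ge0_integral_sum//; first last.
- by move=> v x _; rewrite mule_ge0// lee_fin.
- move=> v; apply: measurable_funeM; apply/measurable_EFinP.
  exact: measurable_indic.
rewrite -sumEFin; apply: eq_bigr => v _.
rewrite ge0_integralZl//; last 2 first.
- by apply/measurable_EFinP; exact: measurable_indic.
- by rewrite lee_fin.
rewrite integral_indic// setIT /law EFinM muleC fineK//.
rewrite ge0_fin_numE// (@le_lt_trans _ _ 1%E) ?ltry// -P1.
by rewrite le_measure// inE//; exact: mh.
Qed.

Variable P : {measure set S -> \bar R}.
Hypothesis P1 : P setT = 1%E.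

Lemma lawK (F : finType) (h : S -> F) v : coded h ->
  (law P h v)%:E = P (h @^-1` [set v]).
Proof.
move=> mh; rewrite /law fineK// ge0_fin_numE//.
rewrite (@le_lt_trans _ _ 1%E) ?ltry// -P1.
by rewrite le_measure// inE//; exact: mh.
Qed.

Lemma law_ge0 (F : finType) (h : S -> F) v : 0 <= law P h v.
Proof. exact: fine_ge0. Qed.

Lemma law_sum1 (F : finType) (h : S -> F) : coded h -> \sum_v law P h v = 1.
Proof.
move=> mh; have := @integral_coded P F h (fun=> 1) mh P1 (fun=> ler01).
rewrite integral_cst// P1 mule1 => -[] ->.
by apply: eq_bigr => v _; rewrite mulr1.
Qed.

Lemma lawE (F F' : finType) (h : S -> F) (g : F -> F') v : coded h ->
  law P (g \o h) v = \sum_(w | g w == v) law P h w.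
Proof.
move=> mh; have mgh := coded_comp g mh.
have -> : law P (g \o h) v = \sum_v' law P (g \o h) v' * (v' == v)%:R.
  rewrite (bigD1 v)//= eqxx mulr1 big1 ?addr0// => v' /negPf ->.
  by rewrite mulr0.
have H := @integral_coded P _ _ (fun v' => (v' == v)%:R) mgh P1 (fun=> ler0n _ _).
have := @integral_coded P _ _ (fun w => (g w == v)%:R) mh P1 (fun=> ler0n _ _).
rewrite /= in H *; rewrite H => -[->].
rewrite [RHS]big_mkcond; apply: eq_bigr => w _.
by case: eqP; rewrite ?mulr1 ?mulr0.
Qed.

Lemma sum_law_comp (F F' : finType) (h : S -> F) (g : F -> F') (u : F' -> R) :
  coded h -> \sum_v law P (g \o h) v * u v = \sum_w law P h w * u (g w).
Proof.
move=> mh; rewrite (partition_big g predT)//=; apply: eq_bigr => v _.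
by rewrite lawE// mulr_suml; apply: eq_bigr => w /eqP ->.
Qed.

End finite_codes.

(** The integral of a nonnegative function is the supremum of the integrals of
the simple functions below it, hence monotone among all nonnegative functions.
Transport costs are compared in this way with functions of finite codes. *)
Lemma le_integral_ge0 d (T : measurableType d) (R : realType)
    (mu : {measure set T -> \bar R}) (f g : T -> \bar R) :
  (forall x, 0 <= f x)%E -> (forall x, f x <= g x)%E ->
  (\int[mu]_x f x <= \int[mu]_x g x)%E.
Proof.
move=> f0 fg; rewrite !ge0_integralTE//; last first.
  by move=> x; rewrite (le_trans (f0 x)).
by apply: le_ereal_sup => _ [h hf <-]; exists h => // x; rewrite (le_trans (hf x)).
Qed.

Lemma exists_mixture d (T : measurableType d) (R : realType) (I : Type)
    (s : seq I) (r : I -> R) (m : I -> {measure set T -> \bar R}) :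
  (forall i, 0 <= r i) ->
  exists mu : {measure set T -> \bar R},
    forall A, mu A = (\sum_(i <- s) (r i)%:E * m i A)%E.
Proof.
move=> r0; elim: s => [|i s [mu muE]].
  by exists mzero => A; rewrite big_nil.
exists (measure_add (mscale (NngNum (r0 i)) (m i)) mu) => A.
by rewrite big_cons -muE; exact: measure_addE.
Qed.

(** * From plans between laws of codes to transport plans *)

Section lifting.
Local Open Scope ereal_scope.
Context (disp : measure_display) (T : measurableType disp) (R : realType).
Variables (F : {measure set T -> \bar R}) (G : probability T R).
Hypothesis F1 : F setT = 1.
Variables (A B : finType) (a : T -> A) (b : T -> B).
Hypotheses (ma : coded a) (mb : coded b).
Variable w : A -> B -> R.
Hypothesis w0 : forall u v, (0 <= w u v)%R.
Hypothesis wl : forall u, (\sum_v w u v)%R = law F a u.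
Hypothesis wr : forall v, (\sum_u w u v)%R = law G b v.

Let G1 : G setT = 1. Proof. exact: probability_setT. Qed.

(* Density of the plan with respect to the product measure on a cell; a cell of
measure 0 gets density 0, which is harmless since it also has weight 0. *)
Let r (uv : A * B) : R :=
  (w uv.1 uv.2 / (law F a uv.1 * law G b uv.2))%R.

Let cell (uv : A * B) : set (T * T) :=
  (a @^-1` [set uv.1]) `*` (b @^-1` [set uv.2]).

Let mcell uv : measurable (cell uv).
Proof. by apply: measurableX; [exact: ma|exact: mb]. Qed.

Let r_ge0 uv : (0 <= r uv)%R.
Proof. by rewrite divr_ge0 ?mulr_ge0// ?w0// law_ge0. Qed.

Let rlaw u v : (r (u, v) * law F a u * law G b v = w u v)%R.
Proof.
rewrite /r/=; have [p0|p0] := eqVneq (law F a u) 0%R.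
  have : (w u v <= 0)%R.
    by rewrite -p0 -wl (bigD1 v)//= lerDl sumr_ge0.
  rewrite p0 mulr0 mul0r => w00.
  by apply/eqP; rewrite eq_le w0 w00.
have [q0|q0] := eqVneq (law G b v) 0%R.
  have : (w u v <= 0)%R.
    by rewrite -q0 -wr (bigD1 u)//= lerDl sumr_ge0.
  by rewrite q0 mulr0 => w00; apply/eqP; rewrite eq_le w0 w00.
by field; apply/andP.
Qed.

Let partition_law (H : {measure set T -> \bar R}) (C : finType) (c : T -> C)
    (E : set T) : coded c -> measurable E ->
  H E = \sum_v H (E `&` c @^-1` [set v]).
Proof.
move=> mc mE.
have EE : E = \bigcup_(v in [set` index_enum C]) (E `&` c @^-1` [set v]).
  apply/seteqP; split => [x Ex|x [v _ []]//].
  by exists (c x); rewrite //= mem_index_enum.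
rewrite {1}EE measure_fin_bigcup//=.
- by rewrite -fsbig_seq// index_enum_uniq.
- apply/trivIsetP => u v _ _ uv; apply/seteqP.
  by split => // x [[_ /= xu] [_ /= xv]]; rewrite -xu -xv eqxx in uv.
- by move=> v _; apply: measurableI => //; exact: mc.
Qed.

Let finF E : measurable E -> F E \is a fin_num.
Proof.
move=> mE; rewrite ge0_fin_numE// (@le_lt_trans _ _ 1)// ?ltry// -F1.
by rewrite le_measure// inE.
Qed.

(** Inside each product of two cells take a multiple of the product measure: the
marginals are then determined by the weights [w] of the cells, and they come out
right because [w] has the laws of the codes as marginals. *)
Lemma coupling_of_laws : exists p : probability (T * T)%type R,
  coupling F G p /\
  forall u v, p (cell (u, v)) = (w u v)%:E.
Proof.
have [mu muE] := @exists_mixture _ (T * T)%type R _ (enum {: A * B}) r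
  (fun uv => mrestr (F \x G) (mcell uv)) r_ge0.
have {}muE E1 E2 : measurable E1 -> measurable E2 -> mu (E1 `*` E2) =
    \sum_u \sum_v (r (u, v))%:E *
      (F (E1 `&` a @^-1` [set u]) * G (E2 `&` b @^-1` [set v])).
  move=> mE1 mE2; rewrite muE big_enum pair_big/=.
  apply: eq_bigr => -[u v] _; congr (_ * _).
  rewrite /mrestr/= -setXI product_measure1E//.
    by apply: measurableI => //; exact: ma.
  by apply: measurableI => //; exact: mb.
have mul E : measurable E -> mu (E `*` setT) = F E.
  move=> mE; rewrite muE// (partition_law _ ma mE).
  apply: eq_bigr => u _.
  have mEu : measurable (E `&` a @^-1` [set u]) by apply: measurableI => //; exact: ma.
  rewrite -(fineK (finF mEu)).
  under eq_bigr => v _ do rewrite setTI -lawK// -!EFinM.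
  rewrite sumEFin; congr EFin.
  have [p0|p0] := eqVneq (law F a u) 0%R.
    have -> : fine (F (E `&` a @^-1` [set u])) = 0%R.
      apply/eqP; rewrite eq_le fine_ge0// andbT -lee_fin fineK ?finF//.
      rewrite -p0 lawK// le_measure// inE//; exact: ma.
    by rewrite big1// => v _; rewrite mul0r mulr0.
  set x := fine _; rewrite (eq_bigr (fun v => x / law F a u * w u v)%R).
    by rewrite -mulr_sumr wl divfK.
  by move=> v _; rewrite -rlaw; field.
have mur E : measurable E -> mu (setT `*` E) = G E.
  move=> mE; rewrite muE// exchange_big (partition_law _ mb mE)/=.
  apply: eq_bigr => v _.
  have mEv : measurable (E `&` b @^-1` [set v]) by apply: measurableI => //; exact: mb.
  have finG : G (E `&` b @^-1` [set v]) \is a fin_num by exact: fin_num_measure.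
  rewrite -(fineK finG).
  under eq_bigr => u _ do rewrite setTI -lawK// -!EFinM.
  rewrite sumEFin; congr EFin.
  have [p0|p0] := eqVneq (law G b v) 0%R.
    have -> : fine (G (E `&` b @^-1` [set v])) = 0%R.
      apply/eqP; rewrite eq_le fine_ge0// andbT -lee_fin fineK//.
      rewrite -p0 lawK// le_measure// inE//; exact: mb.
    by rewrite big1// => u _; rewrite !mulr0.
  set x := fine _; rewrite (eq_bigr (fun u => x / law G b v * w u v)%R).
    by rewrite -mulr_sumr wr divfK.
  by move=> u _; rewrite -rlaw; field.
have mu1 : mu setT = 1 by rewrite -setXTT mul.
pose p := mnormalize mu (dirac point).
have pE E : p E = mu E.
  by rewrite /p /mnormalize/= mu1/= onee_eq0 /= invr1 mule1.
exists p; split.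
  by split => E mE; rewrite [LHS]pE; [exact: mul|exact: mur].
move=> u v; rewrite [LHS]pE /cell muE; [|exact: ma|exact: mb].
rewrite (bigD1 u)//= (bigD1 v)//= !setIid !big1 ?adde0.
- by rewrite -!lawK// -!EFinM mulrA rlaw.
- move=> u' u'u; rewrite big1// => v' _.
  rewrite (_ : _ `&` _ = set0) ?measure0 ?mul0e ?mule0//.
  by apply/seteqP; split => // x [/= -> /esym/eqP]; rewrite (negPf u'u).
- move=> v' v'v; rewrite (_ : b @^-1` _ `&` _ = set0) ?measure0 ?mule0//.
  by apply/seteqP; split => // x [/= -> /esym/eqP]; rewrite (negPf v'v).
Qed.

(** Every upper bound on a Wasserstein distance below goes through this: it is
enough to exhibit a plan between the two laws of codes. *)
Lemma W1_le_code_cost (c : T -> T -> R) (cost : A -> B -> R) :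
  (forall x y, 0 <= c x y)%R ->
  (forall x y, c x y <= cost (a x) (b y))%R ->
  (forall u v, 0 <= cost u v)%R ->
  W1 c F G <= (\sum_u \sum_v w u v * cost u v)%R%:E.
Proof.
move=> c0 ccost cost0; have [p [pFG pw]] := coupling_of_laws.
apply: (@le_trans _ _ (\int[p]_z (c z.1 z.2)%:E)).
  by apply: ereal_inf_lbound; exists p.
pose h (z : T * T) := (a z.1, b z.2).
have hE u v : h @^-1` [set (u, v)] = cell (u, v).
  by apply/seteqP; split => -[x y] /= => [[<- <-]|[/= <- <-]].
have mh : coded h by move=> [u v]; rewrite hE; exact: mcell.
apply: (@le_trans _ _ (\int[p]_z (cost (h z).1 (h z).2)%:E)).
  by apply: le_integral_ge0 => z; rewrite lee_fin.
rewrite (@integral_coded _ _ R p _ h (fun z => cost z.1 z.2))//; last exact: probability_setT.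
rewrite lee_fin pair_big/= le_eqVlt; apply/orP; left; apply/eqP.
by apply: eq_bigr => -[u v] _; rewrite /law hE pw.
Qed.

End lifting.

(** * Matching two point sets along nested partitions *)

Section matching.
Variables (Z : Type) (Q : nat -> finType) (cellmap : forall n, Z -> Q n) (L : nat).
Hypothesis nested : forall n z z', (n < L)%N ->
  cellmap n.+1 z = cellmap n.+1 z' -> cellmap n z = cellmap n z'.

Lemma nested_le m n z z' : (m <= n)%N -> (n <= L)%N ->
  cellmap n z = cellmap n z' -> cellmap m z = cellmap m z'.
Proof.
elim: n m => [|n IH] m; first by rewrite leqn0 => /eqP ->.
rewrite leq_eqVlt => /predU1P[->//|mn nL /(nested nL)].
exact: IH mn (ltnW nL).
Qed.

Variables (N : nat) (x y : 'I_N -> Z).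

Definition mismatches n (s : {perm 'I_N}) : nat :=
  \sum_i (cellmap n (x i) != cellmap n (y (s i))).

Let rho i j : nat := \sum_(n < L.+1) (cellmap n (x i) != cellmap n (y j)).

(** The number of levels at which two points lie in different cells is an
ultrametric on points; this permutation minimises the total ultrametric cost. *)
Definition best_matching : {perm 'I_N} :=
  [arg min_(s < 1%g) (\sum_(n < L.+1) mismatches n s)%N].

Let total_rho s : (\sum_(n < L.+1) mismatches n s = \sum_i rho i (s i))%N.
Proof. by rewrite exchange_big. Qed.

(** If a cell contained both an [x i] whose partner lies outside and the partner
of an [x j] lying outside, exchanging the two partners would decrease the cost:
at the level of the cell one mismatch at least disappears, at finer levels both
pairs were mismatched, and at coarser levels the ultrametric inequality applies. *)
Lemma no_improving_swap n (q : Q n) i j : (n <= L)%N ->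
  cellmap n (x i) = q -> cellmap n (y (best_matching i)) != q ->
  cellmap n (x j) != q -> cellmap n (y (best_matching j)) != q.
Proof.
move=> nL xi yi xj; apply/eqP => yj.
have ij : i != j by apply: contraNneq xj => <-; rewrite xi.
move: xi yi xj yj; rewrite /best_matching; case: arg_minnP => // s _ smin xi yi xj yj.
have := smin (tperm i j * s)%g isT; rewrite leqNgt => /negP; apply.
rewrite !total_rho.
rewrite (bigD1 i)//= (bigD1 j)//=; last by rewrite eq_sym.
rewrite [ltnRHS](bigD1 i)//= [in ltnRHS](bigD1 j)//=; last by rewrite eq_sym.
rewrite !permM tpermL tpermR.
set r1 := bigop _ _ _; set r2 := bigop _ _ _.
have -> : r1 = r2.
  by apply: eq_bigr => k /andP[ki kj]; rewrite permM tpermD// eq_sym.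
rewrite !addnA ltn_add2r /rho -!big_split/=.
have nL' : (n < L.+1)%N by [].
rewrite (bigD1 (Ordinal nL'))//= [ltnRHS](bigD1 (Ordinal nL'))//=.
rewrite -addSn leq_add//.
  rewrite xi yj.
  suff : ((q != q) + (cellmap n (x j) != cellmap n (y (s i))) <
          (q != cellmap n (y (s i))) + (cellmap n (x j) != q))%N by [].
  by rewrite eqxx (eq_sym q) yi xj/=; case: (_ != _).
apply: leq_sum => /= m _.
have [nm|mn] := ltnP n m.
  have -> : cellmap m (x i) != cellmap m (y (s i)).
    apply: contraNneq yi => /(nested_le (ltnW nm) (ltnSE (ltn_ord m))) <-; exact/eqP.
  have -> : cellmap m (x j) != cellmap m (y (s j)).
    by apply: contraNneq xj => /(nested_le (ltnW nm) (ltnSE (ltn_ord m))) ->; exact/eqP.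
  by do 2 case: (_ == _).
have -> : cellmap m (x i) = cellmap m (y (s j)) by apply: nested_le mn nL _; rewrite xi yj.
rewrite eqxx/= add0n.
have [<-|_] := eqVneq (cellmap m (x j)) (cellmap m (y (s j))).
  by rewrite addn0.
by rewrite addn1; case: (_ == _).
Qed.

Definition occ n (v : 'I_N -> Z) (q : Q n) : nat := \sum_i (cellmap n (v i) == q).

(** In each cell, by the absence of improving swaps, either every
point of [x] in the cell has its partner in the cell, or every point of [y] does;
so the mismatches counted there are at most the difference between the numbers
of points of [x] and [y]. One permutation is thus optimal at all levels
simultaneously. *)
Lemma mismatches_best_matching (R : realType) n : (n <= L)%N ->
  (mismatches n best_matching)%:R <=
    \sum_(q : Q n) `|(occ x q)%:R - (occ y q)%:R : R|.
Proof.
move=> nL; set s := best_matching.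
have -> : mismatches n s =
    (\sum_(q : Q n) \sum_i ((cellmap n (x i) == q) && (cellmap n (y (s i)) != q)))%N.
  rewrite exchange_big/=; apply: eq_bigr => i _.
  rewrite (bigD1 (cellmap n (x i)))//= eqxx/= big1 ?addn0 1?eq_sym//.
  by move=> q; rewrite eq_sym => /negPf ->.
rewrite natr_sum; apply: ler_sum => q _.
set A := (\sum_i _)%N.
pose B := (\sum_i ((cellmap n (x i) != q) && (cellmap n (y (s i)) == q)))%N.
pose C := (\sum_i ((cellmap n (x i) == q) && (cellmap n (y (s i)) == q)))%N.
have -> : occ x q = (A + C)%N.
  by rewrite /occ -big_split/=; apply: eq_bigr => i _; do 2 case: (_ == q).
have -> : occ y q = (B + C)%N.
  rewrite /occ (reindex_inj (@perm_inj _ s)) -big_split/=.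
  by apply: eq_bigr => i _; do 2 case: (_ == q).
have [A0|] := boolP [forall i, ~~ ((cellmap n (x i) == q) && (cellmap n (y (s i)) != q))].
  rewrite (_ : A = 0%N) ?normr_ge0//.
  by apply: big1 => i _; move/forallP : A0 => /(_ i) /negPf ->.
rewrite negb_forall => /existsP[i]; rewrite negbK => /andP[/eqP xi yi].
have -> : B = 0%N.
  apply: big1 => j _; apply/eqP; rewrite eqb0; apply/andP => -[xj].
  by apply/negP; exact: no_improving_swap xi yi xj.
by rewrite add0n natrD addrK ler_norm.
Qed.

End matching.

(** * Exchangeable laws on a finite set and their discrepancy *)

Section finite_distributions.
Variables (R : realType) (Z : finType).

Definition permf N (s : {perm 'I_N}) (x : {ffun 'I_N -> Z}) : {ffun 'I_N -> Z} :=
  [ffun i => x (s i)].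

Lemma permf_inj N (s : {perm 'I_N}) : injective (permf s).
Proof.
move=> x y /ffunP xy; apply/ffunP => i.
by have := xy (s^-1%g i); rewrite !ffunE permKV.
Qed.

Definition exchangeable N (p : {ffun 'I_N -> Z} -> R) :=
  forall s x, p (permf s x) = p x.

Lemma exchangeable_sum N (p : {ffun 'I_N -> Z} -> R) s (g : {ffun 'I_N -> Z} -> R) :
  exchangeable p -> \sum_x p x * g (permf s x) = \sum_x p x * g x.
Proof.
move=> ep; rewrite [RHS](reindex_inj (@permf_inj _ s))/=.
by apply: eq_bigr => x _; rewrite ep.
Qed.

Lemma exists_perm_pair N (i j i' j' : 'I_N) : i != j -> i' != j' ->
  exists s : {perm 'I_N}, s i' = i /\ s j' = j.
Proof.
move=> ij ij'; exists (tperm i' i * tperm (tperm i' i j') j)%g.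
split; rewrite permM; last by rewrite tpermL.
rewrite (tpermL i' i); apply: tpermD; last by rewrite eq_sym.
by apply: contraNneq ij' => /(canRL (tpermK _ _)) ->; rewrite tpermR.
Qed.

Lemma exchangeable_pair N (p : {ffun 'I_N -> Z} -> R) (i j i' j' : 'I_N)
    (g : Z -> Z -> R) : exchangeable p -> i != j -> i' != j' ->
  \sum_x p x * g (x i) (x j) = \sum_x p x * g (x i') (x j').
Proof.
move=> ep ij ij'; have [s [<- <-]] := exists_perm_pair ij ij'.
rewrite -(exchangeable_sum s (fun x => g (x i') (x j')) ep).
by apply: eq_bigr => x _; rewrite !ffunE.
Qed.

Lemma exchangeable_one N (p : {ffun 'I_N -> Z} -> R) (i i' : 'I_N)
    (g : Z -> R) : exchangeable p ->
  \sum_x p x * g (x i) = \sum_x p x * g (x i').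
Proof.
move=> ep; rewrite -(exchangeable_sum (tperm i i') (fun x => g (x i')) ep).
by apply: eq_bigr => x _; rewrite !ffunE tpermR.
Qed.

Variable f : Z -> R.
Hypothesis f0 : forall z, 0 <= f z.
Hypothesis f1 : \sum_z f z = 1.

Definition iid_law N (y : {ffun 'I_N -> Z}) : R := \prod_i f (y i).

Lemma iid_ge0 N y : 0 <= @iid_law N y.
Proof. exact: prodr_ge0. Qed.

Lemma iid_exchangeable N : exchangeable (@iid_law N).
Proof.
move=> s x; rewrite /iid_law [RHS](reindex_inj (@perm_inj _ s)).
by apply: eq_bigr => i _; rewrite ffunE.
Qed.

Lemma iid_prod N (u : 'I_N -> Z -> R) :
  \sum_y @iid_law N y * \prod_i u i (y i) = \prod_i \sum_z f z * u i z.
Proof.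
rewrite bigA_distr_bigA/=; apply: eq_bigr => y _.
by rewrite -big_split.
Qed.

Lemma iid_sum1 N : \sum_y @iid_law N y = 1.
Proof.
rewrite -[LHS](bigA_distr_bigA (fun _ : 'I_N => f)).
by rewrite big1.
Qed.

Lemma iid_one N (i : 'I_N) (g : Z -> R) :
  \sum_y @iid_law N y * g (y i) = \sum_z f z * g z.
Proof.
pose u k := if k == i then g else fun=> 1.
transitivity (\sum_y @iid_law N y * \prod_k u k (y k)).
  apply: eq_bigr => y _; rewrite (bigD1 i)//= /u eqxx big1 ?mulr1//.
  by move=> k /negPf ->.
rewrite iid_prod (bigD1 i)//= /u eqxx [X in _ * X]big1 ?mulr1// => k /negPf ->.
by under eq_bigr do rewrite mulr1.
Qed.

Lemma iid_two N (i j : 'I_N) (g h : Z -> R) : i != j ->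
  \sum_y @iid_law N y * (g (y i) * h (y j)) =
  (\sum_z f z * g z) * (\sum_z f z * h z).
Proof.
move=> ij; have ji : j != i by rewrite eq_sym.
pose u k := if k == i then g else if k == j then h else fun=> 1.
transitivity (\sum_y @iid_law N y * \prod_k u k (y k)).
  apply: eq_bigr => y _; rewrite (bigD1 i)//= (bigD1 j)//= big1 ?mulr1.
    by rewrite /u eqxx (negPf ji) eqxx.
  by move=> k /andP[/negPf ki /negPf kj]; rewrite /u ki kj.
rewrite iid_prod (bigD1 i)//= (bigD1 j)//= [X in _ * (_ * X)]big1 ?mulr1.
  by rewrite /u eqxx (negPf ji) eqxx.
move=> k /andP[/negPf ki /negPf kj]; rewrite /u ki kj.
by under eq_bigr do rewrite mulr1.
Qed.

Section discrepancy.
Variables (Q : finType) (cellmap : Z -> Q).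

Definition image_law (q : Q) : R := \sum_(z | cellmap z == q) f z.

Lemma image_law_ge0 q : 0 <= image_law q.
Proof. exact: sumr_ge0. Qed.

Lemma image_law_le1 q : image_law q <= 1.
Proof.
rewrite -f1 /image_law [leRHS](bigID (fun z => cellmap z == q))/= lerDl.
exact: sumr_ge0.
Qed.

Lemma image_law_sum (u : Q -> R) :
  \sum_q image_law q * u q = \sum_z f z * u (cellmap z).
Proof.
rewrite [RHS](partition_big cellmap predT)//=; apply: eq_bigr => q _.
by rewrite mulr_suml; apply: eq_bigr => z /eqP ->.
Qed.

Lemma image_law_sum1 : \sum_q image_law q = 1.
Proof.
rewrite -f1; have := image_law_sum (fun=> 1).
by under eq_bigr do rewrite mulr1; under [in RHS]eq_bigr do rewrite mulr1.
Qed.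

Definition freq N (x : {ffun 'I_N -> Z}) (q : Q) : R :=
  N%:R^-1 * \sum_i (cellmap (x i) == q)%:R.

(** The square is what makes the discrepancy tractable: its mean only involves
the joint law of pairs of particles. *)
Definition discrepancy N (x : {ffun 'I_N -> Z}) : R :=
  \sum_q (freq x q - image_law q) ^+ 2.

(** Centring makes the mean of the kernel vanish for independent particles, see
[iid_pair_kernel]. *)
Definition pair_kernel (a b : Q) : R :=
  \sum_q ((a == q)%:R - image_law q) * ((b == q)%:R - image_law q).

Lemma sum_ind (a : Q) (u : Q -> R) : \sum_q (a == q)%:R * u q = u a.
Proof.
rewrite (bigD1 a)//= eqxx mul1r big1 ?addr0// => q.
by rewrite eq_sym => /negPf ->; rewrite mul0r.
Qed.

Lemma pair_kernelE a b : pair_kernel a b =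
  (a == b)%:R - image_law a - image_law b + \sum_q image_law q ^+ 2.
Proof.
rewrite /pair_kernel; under eq_bigr => q _.
  rewrite (_ : _ * _ = (a == q)%:R * ((b == q)%:R - image_law q)
     - (b == q)%:R * image_law q + image_law q ^+ 2); last by ring.
  over.
by rewrite !big_split/= sumrN !sum_ind (eq_sym b); ring.
Qed.

Lemma pair_kernel_le2 a b : pair_kernel a b <= 2.
Proof.
rewrite pair_kernelE.
have : \sum_q image_law q ^+ 2 <= 1.
  rewrite -image_law_sum1; apply: ler_sum => q _.
  by rewrite expr2 ler_piMl ?image_law_ge0 ?image_law_le1.
have := image_law_ge0 a; have := image_law_ge0 b.
by have : ((a == b)%:R : R) <= 1 by [rewrite lern1 leq_b1]; lra.
Qed.

Lemma pair_kernel_lip a b a' b' : pair_kernel a b - pair_kernel a' b' <=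
  2 * ((a != a')%:R + (b != b')%:R).
Proof.
have [<-|aa] := eqVneq a a'; have [<-|bb] := eqVneq b b'.
- by rewrite subrr addr0 mulr0.
all: rewrite !pair_kernelE/= .
all: have := image_law_ge0 a; have := image_law_ge0 b.
all: have := image_law_le1 a'; have := image_law_le1 b'.
all: have : ((a == b)%:R : R) <= 1 by [rewrite lern1 leq_b1].
all: have : 0 <= ((a' == b')%:R : R) by [].
all: have : 0 <= ((a == b')%:R : R) by [].
all: have : 0 <= ((a' == b)%:R : R) by [].
all: rewrite /=; lra.
Qed.

Lemma discrepancyE N (x : {ffun 'I_N -> Z}) : (0 < N)%N -> discrepancy x =
  N%:R^-1 ^+ 2 * \sum_i \sum_j pair_kernel (cellmap (x i)) (cellmap (x j)).
Proof.
move=> N0; have N0' : (N%:R : R) != 0 by rewrite pnatr_eq0 -lt0n.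
transitivity (\sum_q N%:R^-1 ^+ 2 * \sum_i \sum_j
    (((cellmap (x i) == q)%:R - image_law q) * ((cellmap (x j) == q)%:R - image_law q))).
  apply: eq_bigr => q _.
  have -> : freq x q - image_law q =
      N%:R^-1 * \sum_i ((cellmap (x i) == q)%:R - image_law q).
    by rewrite sumrB sumr_const card_ord -mulr_natl /freq; field.
  rewrite exprMn; congr (_ * _); rewrite expr2 big_distrl/=.
  by apply: eq_bigr => i _; rewrite big_distrr.
rewrite -mulr_sumr; congr (_ * _); rewrite exchange_big/=.
by apply: eq_bigr => i _; rewrite exchange_big.
Qed.

(** Expand the square over pairs of particles. The diagonal contributes O(1/N). *)
Lemma mean_discrepancy_le N (p : {ffun 'I_N -> Z} -> R) (K : R) : (0 < N)%N ->
  (forall x, 0 <= p x) -> \sum_x p x = 1 -> 0 <= K ->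
  (forall i j, i != j ->
    \sum_x p x * pair_kernel (cellmap (x i)) (cellmap (x j)) <= K) ->
  \sum_x p x * discrepancy x <= 2 / N%:R + K.
Proof.
move=> N0 p0 p1 K0 pK; have N0' : (N%:R : R) != 0 by rewrite pnatr_eq0 -lt0n.
under eq_bigr do rewrite discrepancyE// mulrCA mulr_sumr.
rewrite -mulr_sumr exchange_big/=.
have -> : 2 / N%:R + K = N%:R^-1 ^+ 2 * \sum_(i < N) (2 + N%:R * K).
  by rewrite sumr_const card_ord -mulr_natl; field.
rewrite ler_wpM2l ?exprn_ge0// ?invr_ge0//; apply: ler_sum => i _.
under eq_bigr do rewrite mulr_sumr.
rewrite exchange_big/= (bigD1 i)//= lerD//.
  rewrite -[leRHS]mul1r -[X in X * _]p1 mulr_suml; apply: ler_sum => x _.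
  by rewrite ler_wpM2l// pair_kernel_le2.
apply: (@le_trans _ _ (\sum_(j < N | j != i) K)).
  by apply: ler_sum => j ji; rewrite pK// eq_sym.
rewrite mulr_natl -[N in leRHS]card_ord -sumr_const [leRHS](bigID (fun j => j != i))/=.
by rewrite lerDl sumr_ge0.
Qed.

Lemma iid_pair_kernel N (i j : 'I_N) : i != j ->
  \sum_x @iid_law N x * pair_kernel (cellmap (x i)) (cellmap (x j)) = 0.
Proof.
move=> ij; rewrite /pair_kernel.
under eq_bigr do rewrite mulr_sumr.
rewrite exchange_big/= big1// => q _.
pose g z : R := (cellmap z == q)%:R - image_law q.
rewrite (iid_two g g ij) (_ : \sum_z f z * g z = 0) ?mul0r//.
rewrite /g; under eq_bigr do rewrite mulrBr.
rewrite sumrB -mulr_suml f1 mul1r -(image_law_sum (fun q' => (q' == q)%:R)).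
under eq_bigr do rewrite mulrC eq_sym.
by rewrite sum_ind subrr.
Qed.

Lemma mean_discrepancy_iid N : (0 < N)%N ->
  \sum_x @iid_law N x * discrepancy x <= 2 / N%:R.
Proof.
move=> N0; rewrite -[leRHS]addr0; apply: mean_discrepancy_le => //.
- exact: iid_ge0.
- exact: iid_sum1.
by move=> i j ij; rewrite iid_pair_kernel.
Qed.

(** By exchangeability all pairs of distinct particles have the same mean kernel,
which vanishes for independent particles. So it can be read off any pair of
coordinates of the coupling, and the kernel changes between the two sides only
when one of the two coordinates changes cell. Averaging over the cyclic pairs
(a, a + 1), which are pairs of distinct indices as soon as l > 1, makes every
coordinate appear twice. *)
Lemma mean_discrepancy_coupling N l (lN : (l <= N)%N)
    (p : {ffun 'I_N -> Z} -> R)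
    (w : {ffun 'I_l -> Z} -> {ffun 'I_l -> Z} -> R) :
  (1 < l)%N ->
  (forall x, 0 <= p x) -> \sum_x p x = 1 -> exchangeable p ->
  (forall u v, 0 <= w u v) ->
  (forall g : {ffun 'I_l -> Z} -> R,
    \sum_x p x * g [ffun a => x (widen_ord lN a)] = \sum_u \sum_v w u v * g u) ->
  (forall g : {ffun 'I_l -> Z} -> R,
    \sum_y @iid_law l y * g y = \sum_u \sum_v w u v * g v) ->
  \sum_x p x * discrepancy x <= 2 / N%:R +
    4 * \sum_u \sum_v w u v * (l%:R^-1 * \sum_a (cellmap (u a) != cellmap (v a))%:R).
Proof.
move=> l1 p0 p1 ep w0 wp wf.
have l0 : (0 < l)%N by exact: ltnW.
have N0 : (0 < N)%N by exact: (leq_trans l0 lN).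
have l0' : (l%:R : R) != 0 by rewrite pnatr_eq0 -lt0n.
apply: mean_discrepancy_le => //.
  rewrite mulr_ge0// sumr_ge0// => u _; rewrite sumr_ge0// => v _.
  by rewrite !mulr_ge0// ?invr_ge0// sumr_ge0.
move=> i j ij.
set m := (leRHS); set Ep := (leLHS).
have neq a : a != ordS a :> 'I_l.
  apply/eqP => /(congr1 val)/= /eqP.
  have [al|] := ltnP a.+1 l.
    by rewrite modn_small// -[X in X == _]addn0 -addn1 eqn_add2l.
  move=> la; have : a.+1 = l by apply/eqP; rewrite eqn_leq la ltn_ord.
  by move=> e; rewrite e modnn => /eqP a0; move: l1; rewrite -e a0.
have Epa a : Ep <= \sum_u \sum_v w u v *
    (2 * ((cellmap (u a) != cellmap (v a))%:R +
          (cellmap (u (ordS a)) != cellmap (v (ordS a)))%:R)).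
  have -> : Ep = \sum_u \sum_v w u v * (pair_kernel (cellmap (u a)) (cellmap (u (ordS a)))
       - pair_kernel (cellmap (v a)) (cellmap (v (ordS a)))).
    under eq_bigr do under eq_bigr do rewrite mulrBr.
    under eq_bigr do rewrite sumrB.
    rewrite sumrB.
    rewrite -(wp (fun u => pair_kernel (cellmap (u a)) (cellmap (u (ordS a))))).
    rewrite -(wf (fun u => pair_kernel (cellmap (u a)) (cellmap (u (ordS a))))).
    rewrite [X in _ - X](_ : _ = 0) ?subr0.
      under [RHS]eq_bigr do rewrite !ffunE.
      apply: (exchangeable_pair (fun z z' => pair_kernel (cellmap z) (cellmap z'))) => //.
      exact: neq.
    by rewrite iid_pair_kernel.
  apply: ler_sum => u _; apply: ler_sum => v _.
  by rewrite ler_wpM2l// pair_kernel_lip.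
have -> : Ep = l%:R^-1 * \sum_(a < l) Ep.
  by rewrite sumr_const card_ord -[Ep *+ l]mulr_natl mulrA mulVf ?mul1r.
apply: (@le_trans _ _ (l%:R^-1 * \sum_(a < l) \sum_u \sum_v w u v *
    (2 * ((cellmap (u a) != cellmap (v a))%:R +
          (cellmap (u (ordS a)) != cellmap (v (ordS a)))%:R)))).
  by rewrite ler_wpM2l ?invr_ge0// ler_sum.
rewrite le_eqVlt; apply/orP; left; apply/eqP.
rewrite exchange_big/= /m mulr_sumr [in RHS]mulr_sumr; apply: eq_bigr => u _.
rewrite exchange_big/= mulr_sumr [in RHS]mulr_sumr; apply: eq_bigr => v _.
rewrite -mulr_sumr -mulr_sumr big_split/=.
have <- : \sum_(a < l) (cellmap (u a) != cellmap (v a))%:R =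
    \sum_(a < l) (cellmap (u (ordS a)) != cellmap (v (ordS a)))%:R :> R.
  by rewrite [LHS](reindex_inj (can_inj (@ordSK l))).
by ring.
Qed.

End discrepancy.
End finite_distributions.

Section more_discrepancy.
Variables (R : realType) (Z : finType) (f : Z -> R).
Hypothesis f0 : forall z, 0 <= f z.
Hypothesis f1 : \sum_z f z = 1.
Variables (Q : finType) (cellmap : Z -> Q).

Lemma freq_sum N (x : {ffun 'I_N -> Z}) (u : Q -> R) :
  \sum_q freq R cellmap x q * u q = N%:R^-1 * \sum_i u (cellmap (x i)).
Proof.
under eq_bigr do rewrite /freq -mulrA mulr_suml.
rewrite -mulr_sumr exchange_big/=; congr (_ * _).
by apply: eq_bigr => i _; rewrite sum_ind.
Qed.

Lemma freq_ge0 N (x : {ffun 'I_N -> Z}) q : 0 <= freq R cellmap x q.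
Proof. by rewrite mulr_ge0 ?invr_ge0// sumr_ge0. Qed.

Lemma freq_le1 N (x : {ffun 'I_N -> Z}) q : freq R cellmap x q <= 1.
Proof.
case: N x => [|N] x; first by rewrite /freq invr0 mul0r.
rewrite /freq mulrC ler_pdivrMr ?ltr0n// mul1r.
rewrite -[X in _ <= X%:R]card_ord -sum1_card natr_sum.
by apply: ler_sum => i _; rewrite ler_nat leq_b1.
Qed.

(** The discrepancy is the difference of the integrals, against the empirical
measure and against [f], of the function with values [freq - image_law] in
[-1, 1]; a coupling of the two measures sees this function vary only between
points in different cells. *)
Lemma discrepancy_le_empirical_coupling N (x : {ffun 'I_N -> Z})
    (w : Z -> Z -> R) : (forall u v, 0 <= w u v) ->
  (forall g : Z -> R, N%:R^-1 * \sum_i g (x i) = \sum_u \sum_v w u v * g u) ->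
  (forall g : Z -> R, \sum_z f z * g z = \sum_u \sum_v w u v * g v) ->
  discrepancy f cellmap x <=
    2 * \sum_u \sum_v w u v * (cellmap u != cellmap v)%:R.
Proof.
move=> w0 wx wf; pose h q := freq R cellmap x q - image_law f cellmap q.
have -> : discrepancy f cellmap x = \sum_u \sum_v w u v * (h (cellmap u) - h (cellmap v)).
  under [RHS]eq_bigr do under eq_bigr do rewrite mulrBr.
  under [RHS]eq_bigr do rewrite sumrB.
  rewrite sumrB -(wx (fun u => h (cellmap u))) -(wf (fun u => h (cellmap u))).
  rewrite -(freq_sum x h) -(image_law_sum f cellmap h) -sumrB.
  by apply: eq_bigr => q _; rewrite -mulrBl expr2.
rewrite mulr_sumr; apply: ler_sum => u _.
rewrite mulr_sumr; apply: ler_sum => v _.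
rewrite mulrCA ler_wpM2l//.
have [->|_] := eqVneq (cellmap u) (cellmap v); first by rewrite subrr mulr0.
rewrite mulr1 /h.
have := freq_ge0 x (cellmap v); have := freq_le1 x (cellmap u).
have := image_law_ge0 f0 cellmap (cellmap u); have := image_law_le1 f0 f1 cellmap (cellmap v).
lra.
Qed.

(** Young's inequality |a| <= lam / 2 + a^2 / (2 lam) on each cell; the
parameter [lam] is kept free for the final optimisation. *)
Lemma freq_gap_le N (x y : {ffun 'I_N -> Z}) (lam : R) : 0 < lam ->
  (\sum_(q : Q) `|freq R cellmap x q - freq R cellmap y q| : R) <=
    #|Q|%:R * lam + (discrepancy f cellmap x + discrepancy f cellmap y) / (2 * lam).
Proof.
move=> l0.
have young (a : R) : `|a| <= lam / 2 + a ^+ 2 / (2 * lam).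
  have -> : lam / 2 + a ^+ 2 / (2 * lam) = `|a| + (lam - `|a|) ^+ 2 / (2 * lam).
    rewrite -(real_normK (num_real a)); field; lra.
  by rewrite lerDl divr_ge0 ?sqr_ge0// mulr_ge0// ltW.
pose g (z : {ffun 'I_N -> Z}) q : R :=
  lam / 2 + (freq R cellmap z q - image_law f cellmap q) ^+ 2 / (2 * lam).
apply: (@le_trans _ _ (\sum_q (g x q + g y q))).
  apply: ler_sum => q _; set F := image_law f cellmap q.
  have -> : freq R cellmap x q - freq R cellmap y q =
    (freq R cellmap x q - F) - (freq R cellmap y q - F) by ring.
  by rewrite (le_trans (ler_normB _ _))// lerD// young.
rewrite le_eqVlt; apply/orP; left; apply/eqP.
rewrite !big_split/= -!mulr_suml !sumr_const -![lam *+ _]mulr_natl /discrepancy.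
by field; lra.
Qed.

End more_discrepancy.

(** * Transport plans built from a matching *)

Section joint.
Variables (R : realType) (Om A B : finType) (P : Om -> R) (U : Om -> A) (V : Om -> B).

Definition joint_law (u : A) (v : B) : R :=
  \sum_o P o * ((U o == u)%:R * (V o == v)%:R).

Lemma joint_law_ge0 : (forall o, 0 <= P o) -> forall u v, 0 <= joint_law u v.
Proof. by move=> P0 u v; apply: sumr_ge0 => o _; rewrite !mulr_ge0. Qed.

Lemma joint_law_sum (c : A -> B -> R) :
  \sum_u \sum_v joint_law u v * c u v = \sum_o P o * c (U o) (V o).
Proof.
under eq_bigr do under eq_bigr do rewrite mulr_suml.
under eq_bigr do rewrite exchange_big/=.
rewrite exchange_big/=; apply: eq_bigr => o _.
rewrite (bigD1 (U o))//= (bigD1 (V o))//= !eqxx !mulr1.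
rewrite [X in _ + X + _]big1 ?addr0; last first.
  by move=> v; rewrite eq_sym => /negPf ->; rewrite !mulr0 mul0r.
rewrite big1 ?addr0// => u; rewrite eq_sym => /negPf uU.
by rewrite big1// => v _; rewrite uU mul0r mulr0 mul0r.
Qed.

Lemma joint_law_l u : \sum_v joint_law u v = \sum_o P o * (U o == u)%:R.
Proof.
rewrite exchange_big/=; apply: eq_bigr => o _; rewrite -mulr_sumr; congr (_ * _).
rewrite -mulr_sumr; under eq_bigr do rewrite -[(V _ == _)%:R]mulr1.
by rewrite sum_ind mulr1.
Qed.

Lemma joint_law_r v : \sum_u joint_law u v = \sum_o P o * (V o == v)%:R.
Proof.
rewrite exchange_big/=; apply: eq_bigr => o _; rewrite -mulr_sumr; congr (_ * _).
by rewrite sum_ind.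
Qed.

End joint.

Section transport_plans.
Variables (R : realType) (Z : finType) (f : Z -> R).
Hypothesis f0 : forall z, 0 <= f z.
Hypothesis f1 : \sum_z f z = 1.
Variable N : nat.
Hypothesis N0 : (0 < N)%N.
Variable sigma : {ffun 'I_N -> Z} -> {ffun 'I_N -> Z} -> {perm 'I_N}.
Variable cost : Z -> Z -> R.

Definition matching_cost (x y : {ffun 'I_N -> Z}) : R :=
  N%:R^-1 * \sum_i cost (x i) (y (sigma x y i)).

Definition restrictf j (jN : (j <= N)%N) (x : {ffun 'I_N -> Z}) : {ffun 'I_j -> Z} :=
  [ffun a => x (widen_ord jN a)].

Let N0' : (N%:R : R) != 0. Proof. by rewrite pnatr_eq0 -lt0n. Qed.

(** Send the i-th point of [x], each with mass 1/N, to the partner it has in a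
random sample [y] of [f]. *)
Lemma empirical_plan (x : {ffun 'I_N -> Z}) :
  exists w : Z -> Z -> R, [/\ forall u v, 0 <= w u v,
    forall u, \sum_v w u v = N%:R^-1 * \sum_i (x i == u)%:R,
    forall v, \sum_u w u v = f v &
    \sum_u \sum_v w u v * cost u v = \sum_y iid_law f y * matching_cost x y].
Proof.
pose P (o : {ffun 'I_N -> Z} * 'I_N) := iid_law f o.1 * N%:R^-1.
pose U (o : {ffun 'I_N -> Z} * 'I_N) := x o.2.
pose V (o : {ffun 'I_N -> Z} * 'I_N) := o.1 (sigma x o.1 o.2).
exists (joint_law P U V); split.
- by apply: joint_law_ge0 => o; rewrite mulr_ge0 ?invr_ge0 ?iid_ge0.
- move=> u; rewrite joint_law_l -(pair_bigA _ (fun y i => iid_law f y / N%:R * (x i == u)%:R))/=.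
  rewrite -[RHS]mul1r -[X in X * _](iid_sum1 f1 N) mulr_suml.
  by apply: eq_bigr => y _; rewrite -mulr_sumr mulrA.
- move=> v; rewrite joint_law_r.
  rewrite -(pair_bigA _ (fun y i => iid_law f y / N%:R * (y (sigma x y i) == v)%:R))/=.
  transitivity (\sum_y \sum_i iid_law f y / N%:R * ((y : {ffun 'I_N -> Z}) i == v)%:R).
    by apply: eq_bigr => y _; rewrite [RHS](reindex_inj (@perm_inj _ (sigma x y))).
  rewrite exchange_big/=.
  under eq_bigr => i _.
    under eq_bigr do rewrite mulrAC.
    rewrite -mulr_suml (iid_one f1 i (fun z => (z == v)%:R)).
    under eq_bigr do rewrite mulrC eq_sym.
    rewrite sum_ind; over.
  by rewrite sumr_const card_ord -[_ *+ N]mulr_natl; field.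
- rewrite joint_law_sum -(pair_bigA _
    (fun y i => iid_law f y / N%:R * cost (x i) (y (sigma x y i))))/=.
  by apply: eq_bigr => y _; rewrite -mulr_sumr mulrA.
Qed.

Let avg_perm (i : 'I_N) (g : 'I_N -> R) :
  (#|{: {perm 'I_N}}|)%:R^-1 * \sum_(t : {perm 'I_N}) g (t i) =
  N%:R^-1 * \sum_k g k.
Proof.
have c0 : (#|{: {perm 'I_N}}|%:R : R) != 0.
  by rewrite pnatr_eq0 -lt0n; apply/card_gt0P; exists 1%g.
have E k : \sum_(t : {perm 'I_N}) g (t i) = \sum_(t : {perm 'I_N}) g (t k).
  rewrite (reindex_inj (mulgI (tperm i k)))/=.
  by apply: eq_bigr => t _; rewrite permM tpermL.
set A := \sum_(t : {perm 'I_N}) g (t i); set B := \sum_k g k.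
have AN : N%:R * A = \sum_(k < N) A by rewrite sumr_const card_ord mulr_natl.
have Bc : #|{: {perm 'I_N}}|%:R * B = \sum_(t : {perm 'I_N}) B.
  by rewrite sumr_const mulr_natl.
have H : N%:R * A = #|{: {perm 'I_N}}|%:R * B.
  rewrite AN Bc (eq_bigr _ (fun k _ => E k)) exchange_big/=.
  by apply: eq_bigr => t _; rewrite /B [RHS](reindex_inj (@perm_inj _ t)).
apply: (mulfI N0'); rewrite mulrCA H mulrA mulVf// mul1r.
by rewrite mulrA mulfV// mul1r.
Qed.

(** Draw [x] and [y] independently, then apply one uniform random permutation [t]
to the matched pairs (x_i, y_(sigma i)). Given [x] and [y], the composite of [t]
and [sigma x y] is again uniform, so the second marginal is still i.i.d. although
[sigma] depends on both samples. The pairs are now exchangeable, so that the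
mean cost over the first [j] of them is the mean cost over all of them. *)
Lemma symmetrized_plan (p : {ffun 'I_N -> Z} -> R) j (jN : (j <= N)%N) :
  (0 < j)%N ->
  (forall x, 0 <= p x) -> \sum_x p x = 1 -> exchangeable p ->
  exists w : {ffun 'I_j -> Z} -> {ffun 'I_j -> Z} -> R,
    [/\ forall u v, 0 <= w u v,
    forall u, \sum_v w u v = \sum_x p x * (restrictf jN x == u)%:R,
    forall v, \sum_u w u v = iid_law f v &
    \sum_u \sum_v w u v * (j%:R^-1 * \sum_a cost (u a) (v a)) =
      \sum_x \sum_y p x * iid_law f y * matching_cost x y].
Proof.
move=> j0 p0 p1 ep.
have c0 : (#|{: {perm 'I_N}}|%:R : R) != 0.
  by rewrite pnatr_eq0 -lt0n; apply/card_gt0P; exists 1%g.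
set c := #|_| in c0.
pose Om := ({ffun 'I_N -> Z} * {ffun 'I_N -> Z} * {perm 'I_N})%type.
pose P (o : Om) : R := p o.1.1 * iid_law f o.1.2 / c%:R.
pose U (o : Om) := restrictf jN (permf o.2 o.1.1).
pose V (o : Om) := restrictf jN (permf (o.2 * sigma o.1.1 o.1.2)%g o.1.2).
have sumOm (g : Om -> R) :
    \sum_o g o = \sum_x \sum_y \sum_t g (x, y, t).
  by rewrite pair_bigA pair_bigA; apply: eq_bigr => -[[x y] t] _.
exists (joint_law P U V); split.
- by apply: joint_law_ge0 => o; rewrite !mulr_ge0 ?invr_ge0 ?iid_ge0.
- move=> u; rewrite joint_law_l sumOm /P /U/=.
  transitivity (\sum_x \sum_(y : {ffun 'I_N -> Z}) \sum_(t : {perm 'I_N}) iid_law f y / c%:R *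
     (p x * (restrictf jN (permf t x) == u)%:R)).
    apply: eq_bigr => x _; apply: eq_bigr => y _; apply: eq_bigr => t _.
    by ring.
  rewrite exchange_big/=; under eq_bigr => y _.
    rewrite exchange_big/=.
    under eq_bigr do rewrite -mulr_sumr
      (exchangeable_sum _ (fun x => (restrictf jN x == u)%:R) ep).
    rewrite sumr_const -[_ *+ _]mulr_natl mulrA mulrCA mulfV// mulr1.
    over.
  by rewrite -mulr_suml iid_sum1// mul1r.
- move=> v; rewrite joint_law_r sumOm /P /V/=.
  transitivity (\sum_x \sum_(y : {ffun 'I_N -> Z}) \sum_(t : {perm 'I_N}) p x / c%:R *
     (iid_law f y * (restrictf jN (permf t y) == v)%:R)).
    apply: eq_bigr => x _; apply: eq_bigr => y _.
    rewrite [RHS](reindex_inj (mulIg (sigma x y)))/=.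
    apply: eq_bigr => t _.
    by ring.
  under eq_bigr => x _.
    rewrite exchange_big/=.
    under eq_bigr do rewrite -mulr_sumr
      (exchangeable_sum _ (fun y => (restrictf jN y == v)%:R) (@iid_exchangeable _ _ f N)).
    rewrite sumr_const -[_ *+ _]mulr_natl mulrA mulrCA mulfV// mulr1.
    over.
  rewrite -mulr_suml p1 mul1r.
  (* The event that the first j coordinates equal v is a product event, with
     no constraint on the indices i >= j. *)
  transitivity (\sum_y iid_law f y * \prod_(i < N)
     (if insub (val i) is Some a then (y i == v a)%:R else 1)).
    apply: eq_bigr => y _; congr (_ * _).
    have [/eqP <-|] := boolP (_ == v).
      rewrite big1// => i _; case: insubP => // a _ ai.
      by rewrite ffunE (_ : widen_ord _ _ = i) ?eqxx//; exact: val_inj.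
    move=> neq; have [a ya] : exists a, restrictf jN y a != v a.
      apply/existsP; rewrite -negb_forall; apply: contra neq => /forallP H.
      by apply/eqP/ffunP => a; exact/eqP.
    rewrite (bigD1 (widen_ord jN a))//= (_ : insub _ = Some a) ?insubT//.
      move: ya; rewrite ffunE => /negPf ->; by rewrite mul0r.
    by move=> ?; congr Some; exact: val_inj.
  pose u (i : 'I_N) z : R := if insub (val i) is Some a then (z == v a)%:R else 1.
  rewrite (iid_prod f u).
  pose F i : R := if insub i is Some a then f (v a) else 1.
  transitivity (\prod_(0 <= i < N) F i).
    rewrite big_mkord; apply: eq_bigr => i _; rewrite /u /F.
    case: insubP => [a _ _|_]; last by under eq_bigr do rewrite mulr1.
    under eq_bigr do rewrite mulrC eq_sym.
    by rewrite sum_ind.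
  rewrite (big_cat_nat _ jN)//= [X in _ * X]big_nat_cond [X in _ * X]big1 ?mulr1.
    rewrite big_mkord; apply: eq_bigr => a _; rewrite /F insubT//= => ja.
    by congr (f (v _)); exact: val_inj.
  by move=> i /andP[/andP[ji _] _]; rewrite /F insubF// ltnNge ji.
- rewrite joint_law_sum sumOm; apply: eq_bigr => x _; apply: eq_bigr => y _.
  rewrite /P /U /V/=.
  under eq_bigr => t _.
    under eq_bigr do rewrite !ffunE permM.
    rewrite -(mulrA (p x * iid_law f y)).
    over.
  rewrite -mulr_sumr; congr (_ * _).
  under eq_bigr do rewrite mulr_sumr mulr_sumr.
  rewrite exchange_big/=.
  under eq_bigr => a _.
    under eq_bigr do rewrite mulrCA.
    rewrite -mulr_sumr -mulr_sumr (avg_perm _ (fun i => cost (x i) (y (sigma x y i)))).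
    over.
  rewrite sumr_const card_ord -[_ *+ _]mulr_natl mulrA mulfV ?mul1r//.
  by rewrite pnatr_eq0 -lt0n.
Qed.
End transport_plans.

(** * The measures of chaos seen through codes *)

Section tuple_codes.
Context (disp : measure_display) (T : measurableType disp) (R : realType).
Variables (Z : finType) (z : T -> Z).
Hypothesis mz : coded z.

Definition code_tuple n (X : n.-tuple T) : {ffun 'I_n -> Z} :=
  [ffun i => z (tnth X i)].

Lemma coded_tuple n : coded (@code_tuple n).
Proof.
apply: (@coded_ffun _ _ _ _ (fun i X => z (tnth X i))) => i v.
have := measurable_tnth i (measurableT : measurable [set: n.-tuple T]) (mz v).
by rewrite setTI.
Qed.

Lemma code_first_coords N j (jN : (j <= N)%N) (X : N.-tuple T) :
  code_tuple (first_coords j X) = restrictf jN (code_tuple X).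
Proof.
apply/ffunP => i; rewrite !ffunE tnth_mktuple (tnth_nth point).
by [].
Qed.

Lemma law_marginal N (G : probability (N.-tuple T) R) j (jN : (j <= N)%N) u :
  law (marginal G j) (@code_tuple j) u = law G (restrictf jN \o @code_tuple N) u.
Proof.
rewrite /law; congr (fine (G _)); apply/seteqP; split => X /=;
  by rewrite /= -code_first_coords.
Qed.

Lemma law_tensor_power (f : probability T R) n y :
  law (tensor_power f n) (@code_tuple n) y = iid_law (law f z) y.
Proof.
elim: n y => [|n IH] y.
  rewrite /iid_law big_ord0 /law /= /dirac indicE mem_set//=.
  by apply/ffunP => -[].
have tS x (X : n.-tuple T) i : tnth (tcons (x, X)) (lift ord0 i) = tnth X i.
  by rewrite !(tnth_nth x).
pose y' : {ffun 'I_n -> Z} := [ffun i => y (lift ord0 i)].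
have E : @tcons _ T n @^-1` (@code_tuple n.+1 @^-1` [set y]) =
    (z @^-1` [set y ord0]) `*` (@code_tuple n @^-1` [set y']).
  apply/seteqP; split => -[x X] /=.
    move=> yE; split; first by rewrite -yE ffunE.
    by apply/ffunP => i; rewrite !ffunE -yE ffunE tS.
  move=> [xy /ffunP Xy]; apply/ffunP => i; rewrite ffunE.
  case: (unliftP ord0 i) => [a|] ->; last by rewrite -xy.
  by rewrite tS; have := Xy a; rewrite !ffunE.
rewrite /iid_law big_ord_recl.
transitivity (law f z (y ord0) * law (tensor_power f n) (@code_tuple n) y').
  rewrite /law -fineM; last 2 first.
  - exact: fin_num_measure.
  - by apply: fin_num_measure; exact: coded_tuple.
  congr fine; rewrite -product_measure1E//; last exact: coded_tuple.
  by rewrite -E.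
by rewrite IH; congr (_ * _); apply: eq_bigr => i _; rewrite ffunE.
Qed.

Lemma empiricalE N (X : N.-tuple T) (A : set T) :
  empirical R X A = ((N%:R^-1)%:E * \sum_(i < N) \d_(tnth X i) A)%E.
Proof.
rewrite /empirical /mscale/= /msum; congr (_ * _)%E.
by apply: eq_bigr => i _; rewrite (tnth_nth point).
Qed.

Lemma empirical_setT N (X : N.-tuple T) : (0 < N)%N -> empirical R X setT = 1%E.
Proof.
move=> N0; rewrite empiricalE; under eq_bigr do rewrite diracT.
by rewrite sumEFin sumr_const card_ord -EFinM mulVf// pnatr_eq0 -lt0n.
Qed.

Lemma law_empirical N (X : N.-tuple T) u :
  law (empirical R X) z u = N%:R^-1 * \sum_i (code_tuple X i == u)%:R.
Proof.
rewrite /law empiricalE.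
rewrite (eq_bigr (fun i => (code_tuple X i == u)%:R%:E)).
  by rewrite sumEFin -EFinM.
move=> i _; rewrite /dirac indicE ffunE; congr ((nat_of_bool _)%:R%:E).
by apply/idP/idP => [|/eqP]; rewrite inE//= => ->.
Qed.

Lemma law_exchangeable N (G : probability (N.-tuple T) R) :
  (forall (s : {perm 'I_N}) (A : set (N.-tuple T)),
    measurable A -> G (permute s @^-1` A) = G A) ->
  exchangeable (law G (@code_tuple N)).
Proof.
move=> hG s x; rewrite /law -(hG s); last exact: coded_tuple.
congr (fine (G _)); apply/seteqP; split => X /= => [XE|<-].
  apply: (@permf_inj _ _ s); rewrite -XE.
  by apply/ffunP => i; rewrite !ffunE tnth_mktuple.
by apply/ffunP => i; rewrite !ffunE tnth_mktuple.
Qed.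

End tuple_codes.

Lemma W1_ge0 (disp : measure_display) (T : measurableType disp) (R : realType)
    (c : T -> T -> R) (F G : {measure set T -> \bar R}) :
  (forall x y, 0 <= c x y) -> (0 <= W1 c F G)%E.
Proof.
move=> c0; apply: le_ereal_inf_tmp => _ [p _ <-].
by apply: integral_ge0 => z _; rewrite lee_fin.
Qed.

(** If a coupling moves points by [c], then it cannot change a code more than [c]
allows. This is the counterpart of [W1_le_code_cost] for lower bounds. *)
Lemma mean_code_le_integral (disp : measure_display) (S : measurableType disp)
    (R : realType) (p : probability S R) (F : finType) (h : S -> F)
    (e : F -> R) (c : S -> R) (K eta : R) :
  coded h -> 0 < K -> (forall x, 0 <= c x) ->
  (forall x, e (h x) <= K * (c x + eta)) ->
  (((\sum_v law p h v * e v) / K - eta)%:E <= \int[p]_x (c x)%:E)%E.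
Proof.
move=> mh K0 c0 ec; have p1 := probability_setT p.
pose m v : R := Num.max 0 (e v / K - eta).
have m0 v : 0 <= m v by rewrite le_max lexx.
apply: (@le_trans _ _ (\int[p]_x (m (h x))%:E)%E); last first.
  apply: le_integral_ge0 => x; rewrite lee_fin//.
  by rewrite ge_max c0/= lerBlDr ler_pdivrMr// mulrC.
rewrite (integral_coded mh p1 m0).
rewrite lee_fin mulr_suml -[eta]mul1r -(law_sum1 p1 mh) mulr_suml -sumrB.
apply: ler_sum => v _; rewrite -mulrA -mulrBr ler_wpM2l ?law_ge0//.
by rewrite le_max lexx orbT.
Qed.

Section coupling_codes.
Context (disp : measure_display) (T : measurableType disp) (R : realType).
Variables (F G : {measure set T -> \bar R}) (q : probability (T * T)%type R).
Hypothesis qFG : coupling F G q.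
Variables (A : finType) (a : T -> A).
Hypothesis ma : coded a.

Definition pair_code (xy : T * T) : A * A := (a xy.1, a xy.2).

Lemma coded_pair_code : coded pair_code.
Proof.
apply: coded_pair => v.
  rewrite (_ : _ @^-1` _ = (a @^-1` [set v]) `*` setT).
    by apply: measurableX => //; exact: ma.
  by apply/seteqP; split => -[x y] //= [].
rewrite (_ : _ @^-1` _ = setT `*` (a @^-1` [set v])).
  by apply: measurableX => //; exact: ma.
by apply/seteqP; split => -[x y] //= [].
Qed.

Lemma coupling_law_l (g : A -> R) :
  \sum_u \sum_v law q pair_code (u, v) * g u = \sum_u law F a u * g u.
Proof.
rewrite pair_bigA/= (eq_bigr (fun o => law q pair_code o * g o.1)); last by case.
rewrite -(sum_law_comp (probability_setT q) fst g coded_pair_code).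
apply: eq_bigr => u _; congr (_ * _); rewrite /law -qFG.1; last exact: ma.
by congr (fine (q _)); apply/seteqP; split => -[x y] //= [].
Qed.

Lemma coupling_law_r (g : A -> R) :
  \sum_u \sum_v law q pair_code (u, v) * g v = \sum_v law G a v * g v.
Proof.
rewrite pair_bigA/= (eq_bigr (fun o => law q pair_code o * g o.2)); last by case.
rewrite -(sum_law_comp (probability_setT q) snd g coded_pair_code).
apply: eq_bigr => u _; congr (_ * _); rewrite /law -qFG.2; last exact: ma.
by congr (fine (q _)); apply/seteqP; split => -[x y] //= [].
Qed.

End coupling_codes.

Lemma dE_ge0 (R : realType) (d : nat) (x y : 'rV[R]_d) : 0 <= dE x y.
Proof. by rewrite /dE le_min sqrtr_ge0/=. Qed.

Lemma dEj_ge0 (R : realType) (d j : nat) (X Y : j.-tuple (Rd R d)) :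
  0 <= dEj X Y.
Proof. by rewrite mulr_ge0 ?invr_ge0// sumr_ge0// => i _; exact: dE_ge0. Qed.

Section Omega_bounds.
Variables (R : realType) (d : nat) (Z : finType) (z : Rd R d -> Z).
Hypothesis mz : coded z.
Local Notation code n := (@code_tuple _ (Rd R d) Z z n).
Variables (E : set 'rV[R]_d) (f : probability (Rd R d) R) (N : nat).
Variable G : probability (N.-tuple (Rd R d)) R.
Hypothesis N0 : (0 < N)%N.
Hypothesis symG : sym_prob_on E G.

Let f1 := probability_setT f.
Let G1 := probability_setT G.
Let lf0 : forall v, 0 <= law f z v. Proof. by move=> v; exact: law_ge0. Qed.
Let lf1 : \sum_v law f z v = 1. Proof. exact: law_sum1. Qed.
Let mZ n : coded (code n).
Proof. exact: coded_tuple. Qed.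
Let p := law G (code N).
Let p0 : forall x, 0 <= p x. Proof. by move=> x; exact: law_ge0. Qed.
Let p1 : \sum_x p x = 1.
Proof. apply: law_sum1; [exact: probability_setT|exact: mZ]. Qed.
Let ep : exchangeable p. Proof. by apply: law_exchangeable => //; exact: symG.2. Qed.

(** The right-hand side does not depend on [j]: the same matching of a sample of
[G] with an independent sample of the tensor power of [f] bounds all the
measures of chaos at once. *)
Lemma Omega_le_matching (cost : Z -> Z -> R)
    (sigma : {ffun 'I_N -> Z} -> {ffun 'I_N -> Z} -> {perm 'I_N}) j :
  (forall u v, 0 <= cost u v) ->
  (forall x y : Rd R d, dE x y <= cost (z x) (z y)) ->
  chaos_index N j ->
  (Omega G f j <= (\sum_x \sum_y p x * iid_law (law f z) y *
     matching_cost sigma cost x y)%:E)%E.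
Proof.
move=> cost0 dcost; case: j => [j /andP[j0 jN]|_] /=.
  have [w [w0 wl wr <-]] := symmetrized_plan lf0 lf1 N0 sigma cost jN j0 p0 p1 ep.
  rewrite /Omega_fin.
  apply: (@W1_le_code_cost _ (j.-tuple (Rd R d)) R _ _ _ _ _ (code j) (code j)).
  - exact: probability_setT.
  - exact: mZ.
  - exact: mZ.
  - exact: w0.
  - move=> u; rewrite wl law_marginal lawE//; last exact: mZ.
    by rewrite [RHS]big_mkcond; apply: eq_bigr => x _; case: eqP; rewrite ?mulr1 ?mulr0.
  - by move=> v; rewrite wr law_tensor_power.
  - exact: dEj_ge0.
  - move=> X Y; rewrite ler_wpM2l ?invr_ge0//; apply: ler_sum => i _.
    by rewrite !ffunE.
  - by move=> u v; rewrite mulr_ge0 ?invr_ge0// sumr_ge0.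
pose u (x : {ffun 'I_N -> Z}) := \sum_y iid_law (law f z) y * matching_cost sigma cost x y.
have u0 x : 0 <= u x.
  apply: sumr_ge0 => y _; rewrite mulr_ge0 ?iid_ge0//.
  by rewrite mulr_ge0 ?invr_ge0// sumr_ge0.
rewrite /Omega_infty.
apply: (@le_trans _ _ (\int[G]_X (u (code N X))%:E)%E).
  apply: le_integral_ge0 => X; first by apply: W1_ge0 => x y; exact: dE_ge0.
  have [w [w0 wl wr wc]] := empirical_plan lf0 lf1 N0 sigma cost (code N X).
  rewrite /u -wc.
  apply: (@W1_le_code_cost _ _ R (empirical R X) f (empirical_setT _ _ N0) _ _ _ _ mz mz w w0).
  - by move=> v; rewrite wl law_empirical.
  - by move=> v; rewrite wr.
  - by move=> *; exact: dE_ge0.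
  - by [].
  - by [].
rewrite (integral_coded (@mZ N) G1 u0) lee_fin le_eqVlt; apply/orP; left; apply/eqP.
by apply: eq_bigr => x _; rewrite /u mulr_sumr; apply: eq_bigr => y _; rewrite mulrA.
Qed.

Variables (I Q : finType) (cellmap : I -> Z -> Q) (K eta : R).
Hypothesis I0 : (0 < #|I|)%N.
Hypothesis K0 : 0 < K.
Hypothesis cellmapK : forall x y : Rd R d,
  #|I|%:R^-1 * \sum_s (cellmap s (z x) != cellmap s (z y))%:R <= K * (dE x y + eta).

Let I0' : (#|I|%:R : R) != 0. Proof. by rewrite pnatr_eq0 -lt0n. Qed.

Let averageK (a : R) : #|I|%:R^-1 * \sum_(s : I) a = a.
Proof. by rewrite sumr_const -[a *+ _]mulr_natl mulKf. Qed.

(** A shift [s] of the partition separates two points with probability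
O(dE x y + eta), so a coupling of small mean cost changes few cells on average. *)
Lemma mean_discrepancy_le_Omega_fin l : (1 < l <= N)%N ->
  (((#|I|%:R^-1 * \sum_s \sum_x p x * discrepancy (law f z) (cellmap s) x - 2 / N%:R)
     / (4 * K) - eta)%:E <= Omega_fin G f l)%E.
Proof.
move=> /andP[l1 lN]; have l0 : (0 < l)%N by exact: ltnW.
have l0' : (l%:R : R) != 0 by rewrite pnatr_eq0 -lt0n.
apply: le_ereal_inf_tmp => _ [q qGf <-].
pose h := pair_code (code l); have mh : coded h := coded_pair_code (@mZ l).
pose w u v := law q h (u, v).
have w0 u v : 0 <= w u v by exact: law_ge0.
have wp g : \sum_x p x * g [ffun a => x (widen_ord lN a)] = \sum_u \sum_v w u v * g u.
  rewrite (coupling_law_l qGf (@mZ l)); under [RHS]eq_bigr do rewrite law_marginal.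
  by rewrite (sum_law_comp G1 (restrictf lN) g (@mZ N)).
have wf g : \sum_x iid_law (law f z) x * g x = \sum_u \sum_v w u v * g v.
  rewrite (coupling_law_r qGf (@mZ l)).
  by apply: eq_bigr => v _; rewrite law_tensor_power.
pose e (o : {ffun 'I_l -> Z} * {ffun 'I_l -> Z}) : R :=
  l%:R^-1 * \sum_a (#|I|%:R^-1 * \sum_s (cellmap s (o.1 a) != cellmap s (o.2 a))%:R).
have ec XY : e (h XY) <= K * (dEj XY.1 XY.2 + eta).
  apply: (@le_trans _ _ (l%:R^-1 *
      \sum_(a < l) K * (dE (tnth XY.1 a) (tnth XY.2 a) + eta))).
    rewrite ler_wpM2l ?invr_ge0//; apply: ler_sum => a _.
    by rewrite !ffunE; exact: cellmapK.
  rewrite -mulr_sumr big_split/= sumr_const card_ord -[_ *+ _]mulr_natl.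
  by rewrite /dEj le_eqVlt; apply/orP; left; apply/eqP; field.
have := mean_code_le_integral q mh K0 (fun XY => dEj_ge0 XY.1 XY.2) ec.
apply: le_trans; rewrite lee_fin lerB// ler_pdivrMr ?mulr_gt0//.
rewrite mulrCA mulfVK ?gt_eqF// lerBlDr.
apply: (@le_trans _ _ (#|I|%:R^-1 * \sum_(s : I) (2 / N%:R + 4 *
    \sum_u \sum_v w u v * (l%:R^-1 * \sum_a (cellmap s (u a) != cellmap s (v a))%:R)))).
  rewrite ler_wpM2l ?invr_ge0//; apply: ler_sum => s _.
  exact: (@mean_discrepancy_coupling _ _ _ lf0 lf1 _ (cellmap s) _ _ lN _ _
    l1 p0 p1 ep w0 wp wf).
have -> : \sum_o law q h o * e o = #|I|%:R^-1 * \sum_s \sum_u \sum_v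
    w u v * (l%:R^-1 * \sum_a (cellmap s (u a) != cellmap s (v a))%:R).
  transitivity (\sum_u \sum_v w u v * e (u, v)).
    by rewrite pair_bigA/=; apply: eq_bigr; case.
  rewrite mulr_sumr; under [RHS]eq_bigr do rewrite mulr_sumr.
  rewrite [RHS]exchange_big/=; apply: eq_bigr => u _.
  under [RHS]eq_bigr do rewrite mulr_sumr.
  rewrite [RHS]exchange_big/=; apply: eq_bigr => v _.
  by rewrite -!mulr_sumr /e/= -mulr_sumr [in RHS]exchange_big/=; ring.
by rewrite big_split/= mulrDr averageK addrC lerD2r -mulr_sumr mulrCA.
Qed.

(** Here the comparison is made for each configuration X before integrating. *)
Lemma mean_discrepancy_le_Omega_infty :
  (((#|I|%:R^-1 * \sum_s \sum_x p x * discrepancy (law f z) (cellmap s) x)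
     / (2 * K) - eta)%:E <= Omega_infty G f)%E.
Proof.
pose D x := #|I|%:R^-1 * \sum_s discrepancy (law f z) (cellmap s) (x : {ffun 'I_N -> Z}).
pose m x : R := Num.max 0 (D x / (2 * K) - eta).
have m0 x : 0 <= m x by rewrite le_max lexx.
apply: (@le_trans _ _ (\int[G]_X (m (code N X))%:E)%E); last first.
  apply: le_integral_ge0 => X; first by rewrite lee_fin.
  rewrite /m EFin_max ge_max W1_ge0//=; last by move=> x y; exact: dE_ge0.
  apply: le_ereal_inf_tmp => _ [q qXf <-].
  pose h := pair_code z; have mh : coded h := coded_pair_code mz.
  pose w u v := law q h (u, v).
  have w0 u v : 0 <= w u v by exact: law_ge0.
  have wp (g : Z -> R) :
      N%:R^-1 * \sum_i g (code N X i) = \sum_u \sum_v w u v * g u.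
    rewrite (coupling_law_l qXf mz).
    under [RHS]eq_bigr do rewrite law_empirical -mulrA mulr_suml.
    rewrite -mulr_sumr exchange_big/=; congr (_ * _).
    by apply: eq_bigr => i _; rewrite sum_ind.
  have wf (g : Z -> R) : \sum_x law f z x * g x = \sum_u \sum_v w u v * g v.
    by rewrite (coupling_law_r qXf mz).
  pose e (o : Z * Z) : R := #|I|%:R^-1 * \sum_s (cellmap s o.1 != cellmap s o.2)%:R.
  have ec xy : e (h xy) <= K * (dE xy.1 xy.2 + eta) by exact: cellmapK.
  have := mean_code_le_integral q mh K0 (fun xy => dE_ge0 xy.1 xy.2) ec.
  apply: le_trans; rewrite lee_fin lerB// ler_pdivrMr ?mulr_gt0//.
  rewrite mulrCA mulfVK ?gt_eqF//.
  have -> : \sum_o law q h o * e o = #|I|%:R^-1 * \sum_s \sum_u \sum_v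
      w u v * (cellmap s u != cellmap s v)%:R.
    transitivity (\sum_u \sum_v w u v * e (u, v)).
      by rewrite pair_bigA/=; apply: eq_bigr; case.
    rewrite mulr_sumr; under [RHS]eq_bigr do rewrite mulr_sumr.
    rewrite [RHS]exchange_big/=; apply: eq_bigr => u _.
    under [RHS]eq_bigr do rewrite mulr_sumr.
    rewrite [RHS]exchange_big/=; apply: eq_bigr => v _.
    by rewrite -!mulr_sumr /e/= mulrCA.
  rewrite mulrCA ler_wpM2l ?invr_ge0// mulr_sumr; apply: ler_sum => s _.
  exact: (@discrepancy_le_empirical_coupling _ _ _ lf0 lf1 _ (cellmap s)).
rewrite (integral_coded (@mZ N) G1 m0) lee_fin.
have -> : #|I|%:R^-1 * \sum_s \sum_x p x * discrepancy (law f z) (cellmap s) x =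
    \sum_x p x * D x.
  rewrite exchange_big/= mulr_sumr; apply: eq_bigr => x _.
  by rewrite -mulr_sumr mulrCA.
rewrite mulr_suml -[eta in X in X <= _]mul1r -[X in _ - X * _]p1 mulr_suml -sumrB.
apply: ler_sum => x _.
by rewrite -mulrA -mulrBr ler_wpM2l// le_max lexx orbT.
Qed.

Lemma mean_discrepancy_le_Omega l : chaos_index N l -> l <> Some 1%N ->
  (((#|I|%:R^-1 * \sum_s \sum_x p x * discrepancy (law f z) (cellmap s) x - 2 / N%:R)
     / (4 * K) - eta)%:E <= Omega G f l)%E.
Proof.
case: l => [l /andP[l0 lN] l1|_ _].
  apply: mean_discrepancy_le_Omega_fin; rewrite lN andbT ltn_neqAle l0 andbT.
  by apply/eqP => e; apply: l1; rewrite -e.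
apply: le_trans mean_discrepancy_le_Omega_infty.
rewrite lee_fin lerD2r; set A := _ * \sum_s _.
have A0 : 0 <= A.
  rewrite mulr_ge0 ?invr_ge0// sumr_ge0// => s _; rewrite sumr_ge0// => x _.
  by rewrite mulr_ge0//; apply: sumr_ge0 => q _; exact: sqr_ge0.
rewrite ler_pdivrMr ?mulr_gt0//.
have -> : A / (2 * K) * (4 * K) = A + A by field; rewrite gt_eqF.
have : 0 <= 2 / N%:R :> R by rewrite divr_ge0.
lra.
Qed.

End Omega_bounds.

(** * Dyadic cells with a random shift *)

Section shifted_blocks.
Variables (b K : nat).
Hypothesis b0 : (0 < b)%N.

Let b0z : b%:Z != 0. Proof. by rewrite eqz_nat -lt0n. Qed.

(** A wrapped cell can be computed from the integer coordinate itself as well as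
from its residue modulo the period. *)
Lemma block_residue (W e s : nat) (a : int) : W = (K * b)%N ->
  e%:Z = modz a W%:Z ->
  (((e + s) %/ b) %% K)%N%:Z = modz (divz (a + s%:Z) b%:Z) K%:Z.
Proof.
move=> -> ea; rewrite [in RHS](divz_eq a (K * b)%N%:Z) -ea.
rewrite -addrA PoszM mulrA divzMDl// modzMDl.
by rewrite -PoszD divz_nat modz_nat.
Qed.

(** The sum over a full period of shifts telescopes: increasing [a] by one
replaces the term of shift 0 by that of shift K * b. *)
Lemma sum_shifted_blocks (a : int) (t : nat) :
  \sum_(s < K * b) (divz (a + t%:Z + s%:Z) b%:Z - divz (a + s%:Z) b%:Z) =
  (t * K)%N%:Z.
Proof.
elim: t => [|t IH].
  by rewrite big1// => s _; rewrite addr0 subrr.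
pose g (k : nat) := divz (a + t%:Z + k%:Z) b%:Z.
have G : \sum_(s < K * b) (g s.+1 - g s) = K%:Z.
  rewrite -(big_mkord xpredT (fun s => g s.+1 - g s)) telescope_sumr//.
  by rewrite /g PoszM addr0 [a + t%:Z + _]addrC divzMDl// addrK.
rewrite mulSn PoszD -{1}G -IH -big_split/=; apply: eq_bigr => s _.
have -> : a + t.+1%:Z + s%:Z = a + t%:Z + s.+1%:Z.
  by rewrite -addn1 PoszD -(addn1 s) PoszD; ring.
by rewrite /g; ring.
Qed.

(** Block numbers are monotone, so the indicator that a shift separates two
points is at most the difference of their block numbers. *)
Lemma card_shifts_separating (W : nat) (e e' : 'I_W) (a a' : int) :
  W = (K * b)%N ->
  e%:Z = modz a W%:Z -> e'%:Z = modz a' W%:Z ->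
  (\sum_(s < W) (((e + s) %/ b) %% K != ((e' + s) %/ b) %% K) <= `|a - a'| * K)%N.
Proof.
move=> WE ea ea'.
wlog aa' : e e' a a' ea ea' / a <= a'.
  move=> H; have [|/ltW] := lerP a a'; first exact: H.
  move=> /H -/(_ _ _ ea' ea); rewrite distnC.
  by under eq_bigr do rewrite eq_sym.
have [t tE] : exists t : nat, a' = a + t%:Z.
  by exists `|a' - a|%N; rewrite gez0_abs ?subr_ge0//; ring.
have -> : `|a - a'|%N = t by rewrite tE opprD addrA subrr add0r abszN.
rewrite -lez_nat -(sum_shifted_blocks a); subst W.
rewrite (big_morph Posz PoszD (erefl _)); apply: ler_sum => s _.
rewrite -eqz_nat.
rewrite (block_residue s (erefl _) ea) (block_residue s (erefl _) ea') tE.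
set u := divz (a + t%:Z + s%:Z) b%:Z; set v := divz (a + s%:Z) b%:Z.
have vu : v <= u.
  rewrite leNgt /u ltz_divLR ?ltz_nat// -leNgt.
  by rewrite (le_trans (lez_floor _ b0z))// -addrA addrCA lerDr.
case: eqP => [_|uv]; first by rewrite subr_ge0.
have : v != u by apply/eqP => e1; apply: uv; rewrite e1.
by move=> vu'; rewrite -[1%N%:Z]add0r lerBrDr addrC lezD1 lt_neqAle vu' vu.
Qed.

End shifted_blocks.

Lemma absz_gap (u v : int) (c p : nat) : u - v - 1 < c%:Z -> v - u - 1 < c%:Z ->
  (c + p <= `|u - v|)%N -> (0 < p)%N -> u = v.
Proof. lia. Qed.

(** Coordinates are first rounded down to multiples of 1 / fineness. A cell of
level n is a block of [block n] consecutive multiples in each direction, so a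
cube of side 2^-n, and the period wraps the space on a torus of side 2r + 1:
there are finitely many cells, and points of the box of half-side r are
not identified by the wrapping. The shifts are the multiples of 1 / fineness,
the same in every direction and at every level, so that the cells stay nested.
As fineness >= N, the rounding costs no more than 1/N. *)
Section grid.
Variables (R : realType) (d L N r : nat).
Hypothesis N0 : (0 < N)%N.

Definition fineness := (2 ^ L * N)%N.
Definition block n := (2 ^ (L - n) * N)%N.
Definition num_cells n := (2 ^ n * (2 * r).+1)%N.
Definition period := (num_cells L * N)%N.

Lemma block_gt0 n : (0 < block n)%N. Proof. by rewrite muln_gt0 expn_gt0. Qed.
Lemma num_cells_gt0 n : (0 < num_cells n)%N. Proof. by rewrite muln_gt0 expn_gt0. Qed.
Lemma period_gt0 : (0 < period)%N. Proof. by rewrite muln_gt0 num_cells_gt0. Qed.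

Lemma period_block n : (n <= L)%N -> period = (num_cells n * block n)%N.
Proof.
by move=> nL; rewrite /period /num_cells /block -{1}(subnKC nL) expnD; ring.
Qed.

Lemma fineness_block n : (n <= L)%N -> fineness = (2 ^ n * block n)%N.
Proof. by move=> nL; rewrite /fineness /block -{1}(subnKC nL) expnD; ring. Qed.

Definition residue (a : int) : 'I_period :=
  Ordinal (ltn_pmod `|modz a period%:Z| period_gt0).

Lemma residueE a : (residue a)%:Z = modz a period%:Z.
Proof.
have P0 : period%:Z != 0 by rewrite eqz_nat -lt0n period_gt0.
have m0 := modz_ge0 a P0; rewrite /residue/= modn_small ?gez0_abs//.
by rewrite -ltz_nat gez0_abs// ltz_pmod// ltz_nat period_gt0.
Qed.

Definition coord (x : 'rV[R]_d) i : int := Num.floor (fineness%:R * x ord0 i).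

Definition inbox (x : 'rV[R]_d) := [forall i, `|x ord0 i| < r%:R].

(** The flag records whether the point is out of the box. *)
Definition grid (x : Rd R d) : {ffun 'I_d -> 'I_period} * bool :=
  ([ffun i => residue (coord x i)], ~~ inbox x).

Definition cell n (s : 'I_period) (z : {ffun 'I_d -> 'I_period} * bool) :
    {ffun 'I_d -> 'I_(num_cells n)} :=
  [ffun i => Ordinal (ltn_pmod ((z.1 i + s) %/ block n) (num_cells_gt0 n))].

Lemma cell_nested n s z z' : (n < L)%N ->
  cell n.+1 s z = cell n.+1 s z' -> cell n s z = cell n s z'.
Proof.
move=> nL /ffunP H; apply/ffunP => i; apply: val_inj.
have := congr1 val (H i); rewrite !ffunE/=.
have bE : block n = (block n.+1 * 2)%N.
  by rewrite /block -(subnSK nL) expnS; ring.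
have cE : num_cells n.+1 = (num_cells n * 2)%N by rewrite /num_cells expnS; ring.
by rewrite bE !divnMA !(modn_divl _ (num_cells n)) -cE => ->.
Qed.

Lemma enorm_le_sum (x : 'rV[R]_d) : enorm x <= \sum_i `|x ord0 i|.
Proof.
have S0 : 0 <= \sum_(i < d) `|x ord0 i| by exact: sumr_ge0.
rewrite /enorm -(ger0_norm S0) -sqrtr_sqr ler_wsqrtr// expr2 mulr_suml.
apply: ler_sum => i _; rewrite -real_normK ?num_real// expr2 ler_wpM2l//.
by rewrite (bigD1 i)//= lerDl sumr_ge0.
Qed.

Lemma coord_le_enorm (x : 'rV[R]_d) i : `|x ord0 i| <= enorm x.
Proof.
rewrite -sqrtr_sqr /enorm ler_wsqrtr// (bigD1 i)//= lerDl.
by rewrite sumr_ge0// => j _; exact: sqr_ge0.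
Qed.

Let fineness_gt0 : 0 < (fineness%:R : R).
Proof. by rewrite ltr0n muln_gt0 expn_gt0. Qed.

Let floor_gap (u v : R) :
  `|Num.floor u - Num.floor v|%N%:R <= `|u - v| + 1 /\
  `|u - v| < `|Num.floor u - Num.floor v|%N%:R + 1.
Proof.
have -> : (`|Num.floor u - Num.floor v|%N%:R : R) =
    `|(Num.floor u)%:~R - (Num.floor v)%:~R|.
  by rewrite -intrB -intr_norm natr_absz.
have := floor_itv u; have := floor_itv v; rewrite !intrD.
set a : R := (Num.floor u)%:~R; set b : R := (Num.floor v)%:~R.
move=> /andP[b1 b2] /andP[a1 a2].
by split; case: (ger0P (a - b)) => h; case: (ger0P (u - v)) => h'; lra.
Qed.

(** The two blocks coincide modulo [num_cells n] and their numbers differ by less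
than that, so they coincide. *)
Lemma same_block_close n (s : nat) (a a' : int) : (n <= L)%N ->
  (`|a - a'| < 2 * r * fineness)%N ->
  ((residue a + s) %/ block n %% num_cells n = (residue a' + s) %/ block n %% num_cells n)%N ->
  (`|a - a'| < block n)%N.
Proof.
move=> nL aa' H; have bz : 0 < (block n)%:Z by rewrite ltz_nat block_gt0.
have := congr1 Posz H.
rewrite (block_residue (block_gt0 n) s (period_block nL) (residueE a)).
rewrite (block_residue (block_gt0 n) s (period_block nL) (residueE a')).
have b0 : (block n)%:Z != 0 by rewrite gt_eqF.
have := lez_floor (a + s%:Z) b0; have := ltz_ceil (a + s%:Z) bz.
have := lez_floor (a' + s%:Z) b0; have := ltz_ceil (a' + s%:Z) bz.
set A := divz (a + _) _; set A' := divz (a' + _) _ => h1 h2 h3 h4 AA'.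
have {aa'} : `|a - a'| < (2 * r * 2 ^ n)%N%:Z * (block n)%:Z.
  by rewrite -PoszM -abszE ltz_nat -mulnA -fineness_block.
rewrite ltr_norml => /andP[h5 h6].
have h7 : A - A' - 1 < (2 * r * 2 ^ n)%N%:Z.
  by rewrite -(ltr_pM2r bz); lra.
have h8 : A' - A - 1 < (2 * r * 2 ^ n)%N%:Z.
  by rewrite -(ltr_pM2r bz); lra.
have AE : A = A'.
  have : (num_cells n %| `|A - A'|)%N.
    by have := eqz_mod_dvd (num_cells n)%:Z A A'; rewrite AA' eqxx dvdzE => /esym.
  have [|K0 /(dvdn_leq K0)] := posnP `|A - A'|%N.
    by move=> /eqP; rewrite absz_eq0 subr_eq0 => /eqP.
  have -> : num_cells n = (2 * r * 2 ^ n + 2 ^ n)%N by rewrite /num_cells; ring.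
  by move=> /(absz_gap h7 h8) -> //; rewrite expn_gt0.
rewrite -ltz_nat abszE ltr_norml -AE in h1 h2 *.
by apply/andP; split; lra.
Qed.

Lemma same_cell_close n s (x y : Rd R d) : (n <= L)%N -> inbox x -> inbox y ->
  cell n s (grid x) = cell n s (grid y) ->
  enorm (x - y : 'rV[R]_d) <= d%:R / 2 ^+ n.
Proof.
move=> nL /forallP xr /forallP yr /ffunP H.
rewrite (le_trans (enorm_le_sum _))//.
have -> : d%:R / 2 ^+ n = \sum_(i < d) (2 ^+ n)^-1 :> R.
  by rewrite sumr_const card_ord -[(2 ^+ n)^-1 *+ _]mulr_natl.
apply: ler_sum => i _; rewrite !mxE.
have near0 (z : Rd R d) : `|(z : 'rV[R]_d) ord0 i| < r%:R ->
    - (r * fineness)%N%:Z <= coord z i < (r * fineness)%N%:Z.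
  rewrite ltr_norml => /andP[z1 z2]; rewrite /coord.
  rewrite floor_ge_int floor_lt_int mulrNz -pmulrn natrM -mulNr.
  by rewrite ![_ * fineness%:R]mulrC ler_pM2l// ltr_pM2l// ltW.
have /andP[x1 x2] := near0 x (xr i); have /andP[y1 y2] := near0 y (yr i).
have := congr1 val (H i); rewrite !ffunE/= => /(same_block_close nL) B.
have {}B : (`|coord x i - coord y i| < block n)%N.
  apply: B; rewrite -ltz_nat abszE ltr_norml -mulnA mul2n -addnn PoszD.
  by apply/andP; split; lra.
have [_] := floor_gap (fineness%:R * (x : 'rV[R]_d) ord0 i) (fineness%:R * (y : 'rV[R]_d) ord0 i).
rewrite -mulrBr normrM ger0_norm ?ler0n// => lt1.
have : fineness%:R * `|(x : 'rV[R]_d) ord0 i - (y : 'rV[R]_d) ord0 i| < (block n)%:R.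
  by rewrite (lt_le_trans lt1)// natr1 ler_nat.
rewrite (fineness_block nL) natrM natrX mulrAC -{2}[(block n)%:R]mul1r ltr_pM2r ?ltr0n ?block_gt0//.
by move=> lt2; rewrite -[(2 ^+ n)^-1]div1r ler_pdivlMr ?exprn_gt0// mulrC ltW.
Qed.

(** In direction i, a proportion |a - a'| / block n of the shifts separates the
integer coordinates a and a', and |a - a'| <= fineness * |x_i - y_i| + 1. *)
Lemma shifts_separating n (x y : Rd R d) : (n <= L)%N -> (0 < d)%N ->
  period%:R^-1 * \sum_s (cell n s (grid x) != cell n s (grid y))%:R <=
  d%:R * 2 ^+ n * (dE x y + N%:R^-1).
Proof.
move=> nL d0; have P0 : 0 < (period%:R : R) by rewrite ltr0n period_gt0.
have N0' : 0 < (N%:R : R) by rewrite ltr0n.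
have dn1 : 1 <= d%:R * 2 ^+ n :> R.
  by rewrite -natrX -natrM ler1n muln_gt0 d0 expn_gt0.
rewrite mulrC ler_pdivrMr// /dE.
have [_|_] := leP (enorm (x - y : 'rV[R]_d)) 1; last first.
  apply: (@le_trans _ _ (\sum_(s < period) 1)).
    by apply: ler_sum => s _; rewrite lern1 leq_b1.
  rewrite sumr_const card_ord ler_peMl// (le_trans dn1)// ler_peMr ?(le_trans ler01)//.
  by rewrite lerDl invr_ge0 ltW.
apply: (@le_trans _ _ (\sum_(i < d) (`|coord x i - coord y i| * num_cells n)%N%:R)).
  apply: (@le_trans _ _ (\sum_(s < period) \sum_(i < d)
    ((residue (coord x i) + s) %/ block n %% num_cells n
      != (residue (coord y i) + s) %/ block n %% num_cells n)%N%:R)).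
    apply: ler_sum => s _.
    have [_|ne] := eqVneq (cell n s (grid x)) _; first by apply: sumr_ge0.
    have /existsP[i ii] : [exists i, cell n s (grid x) i != cell n s (grid y) i].
      rewrite -negb_forall; apply: contra ne => /forallP H.
      by apply/eqP/ffunP => i; exact/eqP.
    rewrite (bigD1 i)//=; move: ii; rewrite -val_eqE/= !ffunE/= => -> /=.
    by rewrite lerDl sumr_ge0.
  rewrite exchange_big/=; apply: ler_sum => i _; rewrite -natr_sum ler_nat.
  exact: (card_shifts_separating (block_gt0 n) (period_block nL) (residueE _) (residueE _)).
apply: (@le_trans _ _ (\sum_(i < d) (fineness%:R * enorm (x - y : 'rV[R]_d) + 1) * (num_cells n)%:R)).
  apply: ler_sum => i _; rewrite natrM ler_wpM2r//.
  have [+ _] := floor_gap (fineness%:R * (x : 'rV[R]_d) ord0 i) (fineness%:R * (y : 'rV[R]_d) ord0 i).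
  move=> /le_trans; apply; rewrite lerD2r -mulrBr normrM ger0_norm ?ler0n//.
  rewrite ler_wpM2l//; have := coord_le_enorm (x - y : 'rV[R]_d) i.
  by rewrite !mxE.
set e := enorm _; rewrite sumr_const card_ord -[X in X <= _]mulr_natl.
rewrite (period_block nL) (fineness_block nL) !natrM natrX.
set D : R := d%:R; set C : R := (num_cells n)%:R; set B : R := (block n)%:R.
rewrite -subr_ge0 (_ : _ - _ = D * C * (2 ^+ n * B / N%:R - 1)); last first.
  by rewrite /C /B /num_cells /block !natrM !natrX; ring.
rewrite !mulr_ge0// subr_ge0 ler_pdivlMr// mul1r /B -natrX -natrM ler_nat.
by rewrite -fineness_block// /fineness leq_pmull ?expn_gt0.
Qed.

Lemma out_norm (x : Rd R d) : (grid x).2 -> (0 < d)%N -> r%:R <= japanese (x : 'rV[R]_d).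
Proof.
rewrite /grid/= negb_forall => /existsP[i]; rewrite -leNgt => ri d0.
rewrite (le_trans ri)// (le_trans (coord_le_enorm _ i))// /japanese.
rewrite -[leLHS]ger0_norm ?sqrtr_ge0// -sqrtr_sqr ler_wsqrtr//.
by rewrite lerDr.
Qed.

Lemma coded_grid : coded grid.
Proof.
have mcoord i (c : R) : measurable [set x : Rd R d | (x : 'rV[R]_d) ord0 i < c].
  apply: sub_sigma_algebra.
  have := @open_comp _ _ (fun x : 'rV[R]_d => x ord0 i) [set t | t < c].
  apply; last exact: open_lt.
  by move=> x _; exact: coord_continuous.
have mcoordg i (c : R) : measurable [set x : Rd R d | c < (x : 'rV[R]_d) ord0 i].
  apply: sub_sigma_algebra.
  have := @open_comp _ _ (fun x : 'rV[R]_d => x ord0 i) [set t | c < t].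
  apply; last exact: open_gt.
  by move=> x _; exact: coord_continuous.
have mcoord' i (c : R) : measurable [set x : Rd R d | c <= (x : 'rV[R]_d) ord0 i].
  rewrite (_ : [set x | _] = ~` [set x : Rd R d | (x : 'rV[R]_d) ord0 i < c]).
    exact: measurableC.
  by apply/seteqP; split => x /=; rewrite leNgt; move/negP.
apply: coded_pair.
  apply: (@coded_ffun _ (Rd R d) _ _ (fun i x => residue (coord x i))) => i v.
  rewrite (_ : _ @^-1` _ = \bigcup_(a : int) (if residue a == v then
     [set x : Rd R d | a%:~R / fineness%:R <= (x : 'rV[R]_d) ord0 i] `&`
     [set x : Rd R d | (x : 'rV[R]_d) ord0 i < (a + 1)%:~R / fineness%:R] else set0)).
    apply: countable_bigcupT_measurable => // a.
    by case: ifP => // _; exact: measurableI.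
  have fl (x : Rd R d) a : (coord x i == a) =
      (a%:~R / fineness%:R <= (x : 'rV[R]_d) ord0 i) &&
      ((x : 'rV[R]_d) ord0 i < (a + 1)%:~R / fineness%:R).
    by rewrite /coord floor_eq ler_pdivrMr// ltr_pdivlMr// mulrC.
  apply/seteqP; split => x /=.
    move=> <-; exists (coord x i) => //; rewrite eqxx/=.
    by have := fl x (coord x i); rewrite eqxx => /esym/andP.
  move=> [a _]; case: ifP => // /eqP <- [/= a1 a2].
  by have := fl x a; rewrite a1 a2 => /eqP ->.
move=> v; pose A := [set x : Rd R d | inbox x].
have mA : measurable A.
  rewrite (_ : A = \bigcap_(i in [set: 'I_d])
    ([set x : Rd R d | (x : 'rV[R]_d) ord0 i < r%:R] `&`
     [set x : Rd R d | - r%:R < (x : 'rV[R]_d) ord0 i])).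
    apply: fin_bigcap_measurable; first exact: finite_finset.
    by move=> i _; exact: measurableI.
  apply/seteqP; split => x /=.
    by move=> /forallP H i _; have := H i; rewrite ltr_norml => /andP[].
  by move=> H; apply/forallP => i; have [/= h1 h2] := H i I; rewrite ltr_norml h1 h2.
case: v.
  rewrite (_ : _ @^-1` _ = ~` A); first exact: measurableC.
  by apply/seteqP; split => x /=; [move/negP|move=> /negP ->].
rewrite (_ : _ @^-1` _ = A)//.
by apply/seteqP; split => x /=; [move/negbFE|rewrite /A/= => ->].
Qed.

End grid.

(** * The multiscale bound *)

Section averages.
Variables (R : realType) (A B : finType) (p : A -> R) (q : B -> R).
Hypotheses (p1 : \sum_x p x = 1) (q1 : \sum_y q y = 1).

Lemma mean_affine (c : R) (a : A -> R) (b : B -> R) :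
  \sum_x \sum_y p x * q y * (c + a x + b y) =
  c + \sum_x p x * a x + \sum_y q y * b y.
Proof.
transitivity (\sum_x (p x * (c + a x) + p x * \sum_y q y * b y)).
  apply: eq_bigr => x _; under eq_bigr do rewrite -mulrA mulrDr mulrDr.
  rewrite big_split/= -!mulr_sumr; congr (_ + _).
  by rewrite -mulr_suml q1 mul1r.
rewrite big_split/= -mulr_suml p1 mul1r; congr (_ + _).
under eq_bigr do rewrite mulrDr.
by rewrite big_split/= -mulr_suml p1 mul1r.
Qed.

End averages.

Section multiscale.
Variables (R : realType) (d : nat) (E : set 'rV[R]_d) (f : probability (Rd R d) R).
Variables (N : nat) (G : probability (N.-tuple (Rd R d)) R) (L r : nat) (k : R).
Hypothesis d0 : (0 < d)%N.
Hypothesis N0 : (0 < N)%N.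
Hypothesis r0 : (0 < r)%N.
Hypothesis k0 : 0 < k.
Hypothesis symG : sym_prob_on E G.

Local Notation z := (grid L r N0 : Rd R d -> _).
Local Notation Z := ({ffun 'I_d -> 'I_(period L N r)} * bool)%type.
Let mz : coded z. Proof. exact: coded_grid. Qed.
Let p := law G (@code_tuple _ (Rd R d) Z z N).
Let p0 : forall x, 0 <= p x. Proof. by move=> x; exact: law_ge0. Qed.
Let p1 : \sum_x p x = 1.
Proof. apply: law_sum1; [exact: probability_setT|exact: coded_tuple]. Qed.
Let ep : exchangeable p. Proof. by apply: law_exchangeable => //; exact: symG.2. Qed.
Let lf0 : forall v, 0 <= law f z v. Proof. by move=> v; exact: law_ge0. Qed.
Let lf1 : \sum_v law f z v = 1.
Proof. apply: law_sum1; [exact: probability_setT|exact: mz]. Qed.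

Definition grid_cost (s : 'I_(period L N r)) (u v : Z) : R :=
  d%:R / 2 ^+ L + \sum_(n < L.+1) 2 * d%:R / 2 ^+ n * (cell n s u != cell n s v)%:R
  + u.2%:R + v.2%:R.

Lemma grid_cost_ge0 s u v : 0 <= grid_cost s u v.
Proof.
rewrite !addr_ge0// ?divr_ge0 ?exprn_ge0//; apply: sumr_ge0 => n _.
by rewrite mulr_ge0// divr_ge0 ?mulr_ge0 ?exprn_ge0.
Qed.

(** If n is the first level at which the cells of x and y differ, then these
points share a cell of side 2^-(n - 1) = 2 * 2^-n, or n = 0 and dE x y <= 1. *)
Lemma dE_le_grid_cost s (x y : Rd R d) : dE x y <= grid_cost s (z x) (z y).
Proof.
have d1 : 1 <= d%:R :> R by rewrite ler1n.
have S0 (n : 'I_L.+1) : 0 <= 2 * d%:R / 2 ^+ n * (cell n s (z x) != cell n s (z y))%:R :> R.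
  by rewrite mulr_ge0// divr_ge0 ?mulr_ge0 ?exprn_ge0.
have T0 : 0 <= d%:R / 2 ^+ L :> R by rewrite divr_ge0 ?exprn_ge0.
have dE1 : dE x y <= 1 by rewrite /dE ge_min lexx orbT.
have out0 (w : Z) : 0 <= (w.2%:R : R) by [].
pose S := \sum_(n < L.+1) 2 * d%:R / 2 ^+ n * (cell n s (z x) != cell n s (z y))%:R : R.
have SS : 0 <= S by apply: sumr_ge0.
rewrite /grid_cost -/S.
have [xr|xr] := boolP (z x).2; first by have := out0 (z y); rewrite /=; lra.
have [yr|yr] := boolP (z y).2; first by rewrite /=; lra.
rewrite !addr0.
have {}xr : inbox r (x : 'rV[R]_d) by move: xr; rewrite negbK.
have {}yr : inbox r (y : 'rV[R]_d) by move: yr; rewrite negbK.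
have [/forallP same|] := boolP [forall n : 'I_L.+1, cell n s (z x) == cell n s (z y)].
  rewrite (@le_trans _ _ (d%:R / 2 ^+ L))// ?lerDl// /dE ge_min.
  by rewrite (same_cell_close (leqnn L) xr yr (eqP (same ord_max))).
rewrite negb_forall => /existsP[n0 n0P].
have ex : exists n, (n <= L)%N && (cell n s (z x) != cell n s (z y)).
  by exists n0; rewrite n0P -ltnS ltn_ord.
have [n /andP[nL ne] nmin] := ex_minnP ex.
apply: (@le_trans _ _ S); last by rewrite lerDr.
have nL' : (n < L.+1)%N by [].
apply: (@le_trans _ _ (2 * d%:R / 2 ^+ n)); last first.
  rewrite /S (bigD1 (Ordinal nL'))//= ne mulr1 lerDl.
  by apply: sumr_ge0.
case: n nL ne nmin {nL'} => [|n] nL ne nmin.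
  by rewrite expr0 divr1; lra.
have -> : 2 * d%:R / 2 ^+ n.+1 = d%:R / 2 ^+ n :> R.
  by rewrite exprS; field; rewrite expf_neq0.
have same : cell n s (z x) = cell n s (z y).
  apply/eqP/negPn/negP => ne'; have := nmin n; rewrite (ltnW nL) ne' => /(_ isT).
  by rewrite ltnn.
by rewrite /dE ge_min (same_cell_close (ltnW nL) xr yr same).
Qed.

(** Markov's inequality. *)
Lemma out_prob_le (rho : probability (Rd R d) R) (m : R) :
  moment k rho = m%:E -> \sum_v law rho z v * v.2%:R <= m / r%:R `^ k.
Proof.
move=> mE; have rk0 : 0 < (r%:R : R) `^ k by apply: powR_gt0; rewrite ltr0n.
rewrite ler_pdivlMr// mulr_suml.
have := @mean_code_le_integral _ _ R rho _ z (fun v => v.2%:R * r%:R `^ k)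
  (fun x => japanese x `^ k) 1 0 mz ltr01 (fun x => powR_ge0 _ _).
rewrite divr1 subr0 [X in (_ <= X)%E]mE lee_fin => H.
under eq_bigr do rewrite -mulrA; apply: H => x; rewrite mul1r addr0.
have [xr|] := boolP (z x).2; last by rewrite mul0r powR_ge0.
rewrite mul1r; apply: (ge0_ler_powR (ltW k0)); rewrite ?nnegrE ?ler0n ?sqrtr_ge0//.
exact: out_norm xr d0.
Qed.

Lemma law_untuple1 (i : 'I_N) (u : Z -> R) :
  \sum_v law (untuple1 (marginal G 1)) z v * u v = \sum_x p x * u (x i).
Proof.
rewrite (exchangeable_one i (Ordinal N0) u ep).
rewrite -(sum_law_comp (probability_setT G) (fun x : {ffun 'I_N -> Z} => x (Ordinal N0)) u
  (coded_tuple mz (n := N))).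
apply: eq_bigr => v _; congr (_ * _); rewrite /law; congr (fine (G _)).
have H (X : N.-tuple (Rd R d)) : thead1 (first_coords 1 X) = tnth X (Ordinal N0).
  by rewrite /thead1 /thead tnth_mktuple (tnth_nth point).
by apply/seteqP; split => X /=; rewrite ffunE H.
Qed.

Variable lam : R.
Hypothesis lam0 : 0 < lam.

Let Dp n s := \sum_x p x * discrepancy (law f z) (@cell d L N r n s) x.

Definition shifted_bound s Mom : R := d%:R / 2 ^+ L +
  \sum_(n < L.+1) 2 * d%:R / 2 ^+ n *
    ((num_cells r n ^ d)%N%:R * lam + (Dp n s + 2 / N%:R) / (2 * lam)) + Mom / r%:R `^ k.

(** Matching bound, then Young's inequality at each level: the sum over the cells
separates into a discrepancy of the sample of [G] and one of the sample of [f]. *)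
Lemma Omega_le_shifted_bound j s (Mom : R) : chaos_index N j ->
  moment_sum k f G = Mom%:E -> (Omega G f j <= (shifted_bound s Mom)%:E)%E.
Proof.
move=> hj momE.
have [m1 [m2 [m1E m2E m12]]] : exists m1 m2, [/\ moment k f = m1%:E,
    moment k (untuple1 (marginal G 1)) = m2%:E & Mom = m1 + m2].
  have := momE; rewrite /moment_sum.
  have : (0 <= moment k f)%E by apply: integral_ge0 => x _; rewrite lee_fin powR_ge0.
  have : (0 <= moment k (untuple1 (marginal G 1)))%E.
    by apply: integral_ge0 => x _; rewrite lee_fin powR_ge0.
  case: (moment k f) => [a| |]//; case: (moment k _) => [b| |]// _ _ [<-].
  by exists a, b.
pose sigma (x y : {ffun 'I_N -> Z}) := best_matching (fun n => cell n s) L x y.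
apply: (le_trans (Omega_le_matching mz f N0 symG sigma (grid_cost_ge0 s)
  (dE_le_grid_cost s) hj)).
rewrite lee_fin -/p.
pose w n : R := 2 * d%:R / 2 ^+ n.
have w0 n : 0 <= w n by rewrite divr_ge0 ?mulr_ge0 ?exprn_ge0.
pose disc n (x : {ffun 'I_N -> Z}) : R := discrepancy (law f z) (@cell d L N r n s) x.
pose out (x : {ffun 'I_N -> Z}) : R := N%:R^-1 * \sum_i (x i).2%:R.
pose a x := \sum_(n < L.+1) w n * (disc n x / (2 * lam)) + out x.
pose c := d%:R / 2 ^+ L + \sum_(n < L.+1) w n * ((num_cells r n ^ d)%N%:R * lam).
have N0' : (N%:R : R) != 0 by rewrite pnatr_eq0 -lt0n.
have cost_le x y : matching_cost sigma (grid_cost s) x y <= c + a x + a y.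
  have -> : matching_cost sigma (grid_cost s) x y = d%:R / 2 ^+ L +
     \sum_(n < L.+1) w n * (N%:R^-1 * (mismatches (fun n => cell n s) x y n (sigma x y))%:R) +
     out x + out y.
    rewrite /matching_cost /grid_cost !big_split/= sumr_const card_ord.
    rewrite -[(d%:R / 2 ^+ L) *+ N]mulr_natl !mulrDr mulKf//; congr (_ + _ + _ + _).
      rewrite exchange_big/= mulr_sumr; apply: eq_bigr => n _.
      by rewrite -mulr_sumr mulrCA /mismatches natr_sum.
    by rewrite /out [in RHS](reindex_inj (@perm_inj _ (sigma x y))).
  have gap (n : 'I_L.+1) :
      N%:R^-1 * (mismatches (fun n => cell n s) x y n (sigma x y))%:R <=
      (num_cells r n ^ d)%N%:R * lam + (disc n x + disc n y) / (2 * lam) :> R.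
    have nL : (n <= L)%N by rewrite -ltnS ltn_ord.
    have := mismatches_best_matching (fun n => @cell_nested d L N r n s) x y R nL.
    rewrite -/(sigma x y) => mm.
    have cQ : #|{: {ffun 'I_d -> 'I_(num_cells r n)}}| = (num_cells r n ^ d)%N.
      by rewrite card_ffun !card_ord.
    have := freq_gap_le (law f z) (@cell d L N r n s) x y lam0.
    rewrite cQ; apply: le_trans.
    have Ni : 0 <= N%:R^-1 :> R by rewrite invr_ge0.
    apply: (le_trans (ler_wpM2l Ni mm)).
    rewrite mulr_sumr le_eqVlt; apply/orP; left; apply/eqP; apply: eq_bigr => q _.
    rewrite /freq -mulrBr normrM ger0_norm ?invr_ge0// /occ.
    by rewrite !natr_sum.
  rewrite /c /a; set o1 := out x; set o2 := out y.
  set S := (\sum_(n < L.+1) _)%R.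
  have : S <= \sum_(n < L.+1) w n * ((num_cells r n ^ d)%N%:R * lam) +
     \sum_(n < L.+1) w n * (disc n x / (2 * lam)) +
     \sum_(n < L.+1) w n * (disc n y / (2 * lam)).
    rewrite -!big_split/=; apply: ler_sum => n _.
    by rewrite -!mulrDr ler_wpM2l// -addrA -mulrDl gap.
  by lra.
apply: (@le_trans _ _ (\sum_x \sum_y p x * iid_law (law f z) y * (c + a x + a y))).
  apply: ler_sum => x _; apply: ler_sum => y _.
  by rewrite ler_wpM2l// mulr_ge0// iid_ge0.
rewrite (mean_affine p1 (iid_sum1 lf1 N)).
have meana (q : {ffun 'I_N -> Z} -> R) : \sum_x q x * a x =
    \sum_(n < L.+1) w n * ((\sum_x q x * disc n x) / (2 * lam)) + \sum_x q x * out x.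
  under eq_bigr do rewrite mulrDr mulr_sumr.
  rewrite big_split/= exchange_big/=; congr (_ + _); apply: eq_bigr => n _.
  by rewrite mulr_suml mulr_sumr; apply: eq_bigr => x _; ring.
have meanout (q : {ffun 'I_N -> Z} -> R) M : (forall i, \sum_x q x * (x i).2%:R = M) ->
    \sum_x q x * out x = M.
  move=> qM; under eq_bigr do rewrite mulrCA mulr_sumr.
  rewrite -mulr_sumr exchange_big/= (eq_bigr _ (fun i _ => qM i)).
  by rewrite sumr_const card_ord -[M *+ N]mulr_natl mulKf.
rewrite !meana.
rewrite (meanout _ _ (fun i => esym (law_untuple1 i (fun v => v.2%:R)))).
rewrite (meanout _ _ (fun i => iid_one lf1 i (fun v => v.2%:R))).
have o1 := out_prob_le m1E; have o2 := out_prob_le m2E.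
have : \sum_(n < L.+1) w n * ((\sum_y iid_law (law f z) y * disc n y) / (2 * lam)) <=
   \sum_(n < L.+1) w n * ((2 / N%:R) / (2 * lam)).
  have l2 : 0 <= (2 * lam)^-1 by rewrite invr_ge0 mulr_ge0// ltW.
  apply: ler_sum => n _; rewrite ler_wpM2l// ler_wpM2r//.
  exact: (mean_discrepancy_iid lf0 lf1).
move=> idisc; rewrite /shifted_bound m12 (mulrDl m1 m2).
have -> : \sum_(n < L.+1) 2 * d%:R / 2 ^+ n *
    ((num_cells r n ^ d)%N%:R * lam + (Dp n s + 2 / N%:R) / (2 * lam)) =
   \sum_(n < L.+1) w n * ((num_cells r n ^ d)%N%:R * lam) +
   \sum_(n < L.+1) w n * (Dp n s / (2 * lam)) +
   \sum_(n < L.+1) w n * ((2 / N%:R) / (2 * lam)).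
  by rewrite -!big_split/=; apply: eq_bigr => n _; rewrite -!mulrDr -addrA -mulrDl.
rewrite /c -/(Dp _ _); rewrite /Dp; lra.
Qed.

End multiscale.

(** * Choice of the scales *)

Section calculus.
Variable R : realType.

Lemma bernoulli_expr (x : R) n : 0 <= x -> 1 + n%:R * x <= (1 + x) ^+ n.
Proof.
move=> x0; elim: n => [|n IH]; first by rewrite mul0r addr0 expr0.
rewrite exprS; apply: (@le_trans _ _ ((1 + x) * (1 + n%:R * x))).
  rewrite -natr1; have : 0 <= x * (n%:R * x) by rewrite !mulr_ge0.
  by lra.
by rewrite ler_wpM2l// addr_ge0.
Qed.

(** The number of scales is logarithmic in the finest one. *)
Lemma sqr_le_powR_expn (a : R) : 0 < a ->
  exists c : R, 0 < c /\ forall L : nat, (L%:R + 1) ^+ 2 <= c * (2 ^+ L) `^ a.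
Proof.
move=> a0; pose b : R := 2 `^ (a / 2).
have b1 : 1 < b.
  rewrite -(powRr0 2) /b /powR pnatr_eq0/= ltr_expR ltr_pM2r ?divr_gt0//.
  by rewrite ln_gt0// ltr1n.
pose m := Num.min 1 (b - 1).
have m0 : 0 < m by rewrite lt_min ltr01 subr_gt0.
have m1 : m <= 1 by rewrite ge_min lexx.
have mb : m <= b - 1 by rewrite ge_min lexx orbT.
exists (m ^+ 2)^-1; split; first by rewrite invr_gt0 exprn_gt0.
move=> L.
have -> : (2 ^+ L) `^ a = (b ^+ L) ^+ 2.
  have <- : 2 `^ (a / 2 * (L * 2)%:R) = (b ^+ L) ^+ 2.
    by rewrite powRrM powR_mulrn ?powR_ge0// exprM.
  rewrite -(powR_mulrn L (ler0n R 2)) -powRrM natrM.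
  by congr (_ `^ _); field.
rewrite mulrC ler_pdivlMr ?exprn_gt0// -exprMn ler_pXn2r ?nnegrE//.
- have b10 : 0 <= b - 1 by rewrite subr_ge0 ltW.
  have := bernoulli_expr L b10; rewrite (_ : 1 + (b - 1) = b); last by ring.
  apply: le_trans; have : L%:R * m <= L%:R * (b - 1) by rewrite ler_wpM2l.
  by lra.
- by rewrite mulr_ge0 ?addr_ge0// ltW.
- by rewrite exprn_ge0// powR_ge0.
Qed.

Lemma exists_dyadic (t : R) : 1 <= t -> exists L : nat, t <= 2 ^+ L <= 2 * t.
Proof.
move=> t1; have t0 : 0 <= t by exact: le_trans t1.
have ex : exists L : nat, t <= 2 ^+ L.
  exists (Num.truncn t).+1; have /andP[_ /ltW/le_trans] := truncn_itv t0; apply.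
  by rewrite -natrX ler_nat ltnW// ltn_expl.
have [L tL Lmin] := ex_minnP ex; exists L; rewrite tL/=.
case: L tL Lmin => [|L] tL Lmin; first by rewrite expr0; lra.
rewrite exprS ler_pM2l// leNgt; apply/negP => /ltW /Lmin.
by rewrite ltnn.
Qed.

Lemma exists_nat_near (t : R) : 1 <= t -> exists r : nat, (0 < r)%N /\ t <= r%:R <= 2 * t.
Proof.
move=> t1; have t0 : 0 <= t by exact: le_trans t1.
exists (Num.truncn t).+1; split => //.
have /andP[h1 h2] := truncn_itv t0; rewrite (ltW h2)/= -natr1; lra.
Qed.

(** [L] is the finest level, [r] the half-side of the box, [lam] the parameter of
Young's inequality, [A] stands for Omega_l + 1/N and [Mom] for the moments. The
three terms bound the transport inside the finest cells, between cells, and out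
of the box. *)
Definition multiscale_bound (d : nat) (k : R) (L r : nat) (lam A Mom : R) : R :=
  d%:R / 2 ^+ L +
  (L%:R + 1) * (2 * d%:R * (((2 * r).+1 ^ d)%N%:R * (2 ^+ L) ^+ d.-1 * lam +
                      4 * d%:R * A / lam)) +
  Mom / r%:R `^ k.

(** With eta = Mom^(1/k) A^g, take cells of side 2^-L of order eta, a box with
r of order Mom^(1/k) eta^(-1/k), and [lam] such that the second part of the
middle term is of order eta. The first part is then of order eta as soon as
(L + 1)^2 Mom^(d/k) A <= c eta^(d + 1 + d/k), where L + 1 is O(log(1/A)): the
powers of A balance at the exponent 1 / (d + 1 + d/k), and the strict
inequality on [g] leaves a power of A that absorbs the logarithm. If eta >= 1,
the bound x <= 1 suffices. *)
Lemma optimal_scale (d : nat) (k g : R) : (0 < d)%N -> 0 < k -> 0 < g ->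
  g < (d%:R + 1 + d%:R / k)^-1 ->
  exists C : R, 0 < C /\ forall x A Mom : R, 0 < A -> 1 <= Mom -> x <= 1 ->
    (forall L r lam, (0 < r)%N -> 0 < lam ->
      x <= multiscale_bound d k L r lam A Mom) ->
    x <= C * Mom `^ k^-1 * A `^ g.
Proof.
move=> d0 k0 g0; set q : R := d%:R + 1 + d%:R / k => gq.
have q0 : 0 < q by rewrite /q addr_gt0 ?divr_gt0 ?ltr0n// addr_gt0 ?ltr0n.
pose th := 1 - g * q.
have th0 : 0 < th by rewrite subr_gt0 -ltr_pdivlMr// div1r.
have [c [c0 cL]] := sqr_le_powR_expn (divr_gt0 th0 g0).
pose c2 := c * 2 `^ (th / g).
have c20 : 0 < c2 by rewrite mulr_gt0// powR_gt0.
pose D : R := 2 * d%:R * 6 ^+ d * 2 ^+ d.-1.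
have D0 : 0 <= D by rewrite !mulr_ge0 ?exprn_ge0.
exists (d%:R + 8 * d%:R ^+ 2 + D * c2 + 1); split.
  by rewrite ltr_wpDl// !addr_ge0 ?mulr_ge0// ltW.
move=> x A Mom A0 Mom1 x1 xle.
pose u := Mom `^ k^-1; pose eta := u * A `^ g.
have Mom0 : 0 < Mom by exact: lt_le_trans Mom1.
have u1 : 1 <= u.
  by rewrite /u -[leLHS](powRr0 Mom) ler_powR// invr_ge0 ltW.
have u0 : 0 < u by exact: lt_le_trans u1.
have eta0 : 0 < eta by rewrite mulr_gt0// powR_gt0.
have [A0' u0' eta0' k0' [c20' Mom0']] :
    [/\ 0 <= A, 0 <= u, 0 <= eta, 0 <= k & 0 <= c2 /\ 0 <= Mom].
  by do !split; exact: ltW.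
rewrite -mulrA -/u -/eta.
have C1 : 1 <= d%:R + 8 * d%:R ^+ 2 + D * c2 + 1.
  by rewrite lerDr !addr_ge0// ?mulr_ge0// ltW.
have [eta1|eta1] := leP 1 eta.
  by rewrite (le_trans x1)// -[leLHS]mul1r ler_pM.
have ieta1 : 1 <= eta^-1 by rewrite invf_ge1// ltW.
have [L /andP[L1 L2]] := exists_dyadic ieta1.
pose rho := u * eta `^ (- k^-1).
have ek : eta `^ (- k^-1) = (eta `^ k^-1)^-1 by rewrite powRN.
have ek0 : 0 < eta `^ k^-1 by rewrite powR_gt0.
have rho1 : 1 <= rho.
  rewrite /rho -[leLHS]mul1r ler_pM// ek invf_ge1//.
  by rewrite -[leRHS](powRr0 eta) ger_powR ?eta0 ?(ltW eta1)// invr_ge0.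
have rho0 : 0 < rho by exact: lt_le_trans rho1.
have rho0' : 0 <= rho by exact: ltW.
have [r [r0 /andP[r1 r2]]] := exists_nat_near rho1.
pose lam := A * (L%:R + 1) / eta.
have L0 : 0 < L%:R + 1 :> R by rewrite ltr_wpDl.
have lam0 : 0 < lam by rewrite divr_gt0// mulr_gt0.
have [lam0' L0'] : 0 <= lam /\ 0 <= L%:R + 1 :> R by split; exact: ltW.
apply: (le_trans (xle L r lam r0 lam0)); rewrite /multiscale_bound.
have tail : Mom / r%:R `^ k <= eta.
  rewrite ler_pdivrMr ?powR_gt0 ?ltr0n//.
  apply: (@le_trans _ _ (eta * rho `^ k)); last first.
    by rewrite ler_wpM2l// ge0_ler_powR ?nnegrE.
  rewrite /rho powRM ?powR_ge0// /u -!powRrM mulVf ?gt_eqF// powRr1//.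
  by rewrite mulNr mulVf ?gt_eqF// powR_inv1// mulrCA mulfV ?gt_eqF// mulr1.
have fine : d%:R / 2 ^+ L <= d%:R * eta.
  by rewrite ler_wpM2l// invf_ple ?posrE ?exprn_gt0.
(* th is the power of A left by the strict inequality on g. *)
have main : (L%:R + 1) ^+ 2 * u ^+ d * A <= c2 * eta `^ q.
  have Lc : (L%:R + 1) ^+ 2 <= c2 * A `^ (- th).
    apply: (le_trans (cL L)); rewrite /c2 -mulrA ler_wpM2l ?(ltW c0)//.
    have -> : A `^ (- th) = (A `^ (- g)) `^ (th / g).
      by rewrite -powRrM; congr (_ `^ _); field; rewrite gt_eqF.
    rewrite -(powRM _ (ler0n R 2) (powR_ge0 A (- g))).
    have t0 : 0 <= th / g by rewrite divr_ge0// ltW.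
    apply: (ge0_ler_powR t0); rewrite ?nnegrE ?exprn_ge0//.
      by rewrite mulr_ge0// powR_ge0.
    apply: (le_trans L2); rewrite ler_wpM2l// powRN lef_pV2 ?posrE ?powR_gt0//.
    by rewrite /eta ler_peMl ?powR_ge0.
  apply: (@le_trans _ _ (c2 * A `^ (- th) * u ^+ d * A)).
    by rewrite !ler_wpM2r ?exprn_ge0.
  rewrite -(mulrA (c2 * _)) -(mulrA c2) ler_wpM2l// /eta powRM ?powR_ge0// -powRrM.
  rewrite mulrCA -[X in A `^ _ * X](powRr1 A0') -powRD ?(gt_eqF A0) ?implybT//.
  have -> : - th + 1 = g * q by rewrite /th; ring.
  rewrite ler_wpM2r ?powR_ge0// -powR_mulrn// ler_powR//.
  by rewrite /q -addrA lerDl addr_ge0 ?divr_ge0.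
have bulk : (L%:R + 1) * (2 * d%:R * (((2 * r).+1 ^ d)%N%:R * (2 ^+ L) ^+ d.-1 * lam))
    <= D * c2 * eta.
  have M6 : ((2 * r).+1 ^ d)%N%:R <= 6 ^+ d * rho ^+ d :> R.
    rewrite natrX -exprMn lerXn2r ?nnegrE ?mulr_ge0 ?powR_ge0//.
    have : 1 <= r%:R :> R by rewrite ler1n.
    by rewrite -natr1 natrM; lra.
  have L6 : (2 ^+ L) ^+ d.-1 <= 2 ^+ d.-1 * (eta^-1) ^+ d.-1 :> R.
    rewrite -exprMn lerXn2r ?nnegrE ?exprn_ge0 ?mulr_ge0 ?invr_ge0//.
  apply: (@le_trans _ _ ((L%:R + 1) * (2 * d%:R * ((6 ^+ d * rho ^+ d) *
     (2 ^+ d.-1 * (eta^-1) ^+ d.-1) * lam)))).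
    rewrite ler_wpM2l// ler_wpM2l ?mulr_ge0// ler_wpM2r//.
    by rewrite ler_pM// ?exprn_ge0.
  have -> : (L%:R + 1) * (2 * d%:R * ((6 ^+ d * rho ^+ d) *
     (2 ^+ d.-1 * (eta^-1) ^+ d.-1) * lam)) =
     D * ((L%:R + 1) ^+ 2 * A * rho ^+ d * eta^-1 ^+ d).
    by rewrite -(prednK d0) [eta^-1 ^+ d.-1.+1]exprSr /D /lam (prednK d0); ring.
  rewrite -(mulrA D) ler_wpM2l//.
  rewrite exprVn ler_pdivrMr ?exprn_gt0// -(mulrA c2) -exprS.
  rewrite -(ler_pM2r (powR_gt0 (d%:R / k) eta0)).
  have ekd : eta `^ (d%:R / k) = (eta `^ k^-1) ^+ d.
    by rewrite mulrC powRrM powR_mulrn ?powR_ge0.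
  have -> : (L%:R + 1) ^+ 2 * A * rho ^+ d * eta `^ (d%:R / k) =
      (L%:R + 1) ^+ 2 * u ^+ d * A.
    rewrite ekd -mulrA -exprMn /rho ek mulfVK ?gt_eqF//; ring.
  have -> : c2 * eta ^+ d.+1 * eta `^ (d%:R / k) = c2 * eta `^ q.
    rewrite -mulrA; congr (_ * _); rewrite -powR_mulrn// -powRD.
      by rewrite -natr1.
    by rewrite (gt_eqF eta0) implybT.
  exact: main.
have rest : (L%:R + 1) * (2 * d%:R * (4 * d%:R * A / lam)) = 8 * d%:R ^+ 2 * eta.
  by rewrite /lam; field; rewrite !gt_eqF.
rewrite !mulrDr rest !mulrDl mul1r; lra.
Qed.

End calculus.

Lemma le_mean_ereal (R : realType) (I : finType) (x : \bar R) (b : I -> R) :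
  (0 < #|I|)%N -> (forall s, x <= (b s)%:E)%E ->
  (x <= (#|I|%:R^-1 * \sum_s b s)%:E)%E.
Proof.
move=> I0 xb; have [s0 _] := card_gt0P I0.
have I0' : (#|I|%:R : R) != 0 by rewrite pnatr_eq0 -lt0n.
move: xb; case: x => [x| |] xb; last by rewrite leNye.
  rewrite lee_fin -(mulKf I0' x) ler_wpM2l ?invr_ge0//.
  rewrite mulr_natl -sumr_const; apply: ler_sum => s _.
  by rewrite -lee_fin.
by have := xb s0; rewrite leye_eq.
Qed.

Section comparison.
Variables (R : realType) (d : nat) (E : set 'rV[R]_d) (f : probability (Rd R d) R).
Variables (N : nat) (G : probability (N.-tuple (Rd R d)) R) (k : R).
Hypothesis d0 : (0 < d)%N.
Hypothesis N0 : (0 < N)%N.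
Hypothesis k0 : 0 < k.
Hypothesis symG : sym_prob_on E G.

Lemma Omega_ge0 j : (0 <= Omega G f j)%E.
Proof.
case: j => [j|] /=; last first.
  by apply: integral_ge0 => X _; apply: W1_ge0 => x y; exact: dE_ge0.
by apply: W1_ge0 => X Y; exact: dEj_ge0.
Qed.

(** A trivial code and the constant cost 1. *)
Lemma Omega_le1 j : chaos_index N j -> (Omega G f j <= 1)%E.
Proof.
move=> hj.
have mz : @coded _ (Rd R d) unit (fun=> tt).
  move=> []; rewrite (_ : _ @^-1` _ = setT); first exact: measurableT.
  by apply/seteqP; split.
apply: (le_trans (@Omega_le_matching _ _ _ _ mz E f N G N0 symG (fun _ _ => 1)
  (fun _ _ => 1%g) j (fun _ _ => ler01) _ hj)).
  by move=> x y; rewrite /dE ge_min lexx orbT.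
rewrite lee_fin /matching_cost.
under eq_bigr do under eq_bigr do rewrite sumr_const card_ord mulVf ?pnatr_eq0 -?lt0n// mulr1.
under eq_bigr do rewrite -mulr_sumr.
rewrite -mulr_suml iid_sum1 ?mulr1; last first.
  by apply: law_sum1 => //; exact: probability_setT.
rewrite (@law_sum1 _ _ _ G)//; [exact: probability_setT|exact: coded_tuple].
Qed.

Lemma moment_ge1 (rho : probability (Rd R d) R) : (1 <= moment k rho)%E.
Proof.
apply: (@le_trans _ _ (\int[rho]_x (cst 1%E x))%E).
  rewrite integral_cst// mul1e le_eqVlt; apply/orP; left.
  by apply/eqP/esym; exact: probability_setT.
rewrite /moment; apply: le_integral_ge0 => x //=; rewrite lee_fin.
have j1 : 1 <= japanese (x : 'rV[R]_d).
  by rewrite /japanese -[leLHS]sqrtr1 ler_wsqrtr// lerDl sqr_ge0.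
by rewrite -[leLHS](powRr0 (japanese (x : 'rV[R]_d))) ler_powR// ltW.
Qed.

(** Omega_j is bounded for every shift, hence by the mean over the shifts, where
[mean_discrepancy_le_Omega] applies. Since d >= 1, the cost 2^-n times the number
of cells of level n is largest at the finest level. *)
Lemma Omega_le_multiscale (j l : option nat) (L r : nat) (lam om Mom : R) :
  (0 < r)%N -> 0 < lam -> chaos_index N j -> chaos_index N l -> l <> Some 1%N ->
  Omega G f l = om%:E -> moment_sum k f G = Mom%:E ->
  (Omega G f j <= (multiscale_bound d k L r lam (om + N%:R^-1) Mom)%:E)%E.
Proof.
move=> r0 lam0 hj hl hl1 omE momE.
set A := om + N%:R^-1.
have om0 : 0 <= om by have := Omega_ge0 l; rewrite omE lee_fin.
have N0' : (N%:R : R) != 0 by rewrite pnatr_eq0 -lt0n.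
have Ni : 0 <= N%:R^-1 :> R by rewrite invr_ge0.
have P0 : (0 < period L N r)%N by exact: period_gt0.
have I0 : (0 < #|'I_(period L N r)|)%N by rewrite card_ord.
apply: (le_trans (le_mean_ereal I0
  (fun s => Omega_le_shifted_bound d0 N0 r0 k0 symG lam0 s hj momE))).
rewrite lee_fin card_ord.
have P0' : ((period L N r)%:R : R) != 0 by rewrite pnatr_eq0 -lt0n.
have avg (a : R) : (period L N r)%:R^-1 * \sum_(s : 'I_(period L N r)) a = a.
  by rewrite sumr_const card_ord -[a *+ _]mulr_natl mulKf.
have d1 : 1 <= d%:R :> R by rewrite ler1n.
rewrite /shifted_bound /multiscale_bound 2!big_split/= [leLHS]mulrDr.
rewrite [X in X + _ <= _]mulrDr !avg.
rewrite lerD2r lerD2l exchange_big/= mulr_sumr.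
have -> : (L%:R + 1) * (2 * d%:R * (((2 * r).+1 ^ d)%N%:R * (2 ^+ L) ^+ d.-1 * lam +
                      4 * d%:R * A / lam)) =
    \sum_(n < L.+1) (2 * d%:R * (((2 * r).+1 ^ d)%N%:R * (2 ^+ L) ^+ d.-1 * lam +
                      4 * d%:R * A / lam)).
  by rewrite sumr_const card_ord -[X in _ = X]mulr_natl natr1.
apply: ler_sum => n _.
have nL : (n <= L)%N by rewrite -ltnS ltn_ord.
have n0 : 0 < 2 ^+ n :> R by rewrite exprn_gt0.
have K0 : 0 < d%:R * 2 ^+ n :> R by rewrite mulr_gt0// ltr0n.
pose Z := ({ffun 'I_d -> 'I_(period L N r)} * bool)%type.
pose z : Rd R d -> Z := grid L r N0.
pose D (s : 'I_(period L N r)) : R := \sum_x law G (@code_tuple _ (Rd R d) Z z N) x *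
   discrepancy (law f z) (@cell d L N r n s) x.
have cellmapK (x y : Rd R d) : #|'I_(period L N r)|%:R^-1 *
    \sum_s (cell n s (z x) != cell n s (z y))%:R <= d%:R * 2 ^+ n * (dE x y + N%:R^-1).
  by rewrite card_ord; exact: shifts_separating.
have mz : coded z by exact: coded_grid.
have := mean_discrepancy_le_Omega mz f symG I0 K0 cellmapK hl hl1.
rewrite omE lee_fin card_ord => mD.
have {}mD : (period L N r)%:R^-1 * \sum_s D s <= 2 / N%:R + 4 * (d%:R * 2 ^+ n) * A.
  have K4 : 0 < 4 * (d%:R * 2 ^+ n) :> R by exact: mulr_gt0.
  move: mD; rewrite -/D lerBlDr ler_pdivrMr// -/A => mD.
  by rewrite -lerBlDl (le_trans mD)// mulrC.
have -> : (period L N r)%:R^-1 * \sum_s 2 * d%:R / 2 ^+ n *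
    ((num_cells r n ^ d)%N%:R * lam + (D s + 2 / N%:R) / (2 * lam)) =
  2 * d%:R / 2 ^+ n * ((num_cells r n ^ d)%N%:R * lam +
    ((period L N r)%:R^-1 * \sum_s D s + 2 / N%:R) / (2 * lam)).
  rewrite -mulr_sumr mulrCA; congr (_ * _).
  by rewrite big_split/= mulrDr avg -mulr_suml big_split/= mulrA mulrDr avg.
set V := _ * \sum_s D s in mD *.
have -> : 2 * d%:R / 2 ^+ n * ((num_cells r n ^ d)%N%:R * lam + (V + 2 / N%:R) / (2 * lam)) =
    2 * d%:R * ((num_cells r n ^ d)%N%:R / 2 ^+ n * lam + (V + 2 / N%:R) / (2 * 2 ^+ n * lam)).
  by field; rewrite N0' !gt_eqF.
rewrite ler_wpM2l ?mulr_ge0// lerD//.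
  rewrite ler_wpM2r ?(ltW lam0)// ler_pdivrMr// /num_cells expnMn natrM mulrC -mulrA.
  rewrite ler_wpM2l// natrX -[d in leLHS](prednK d0) natrX exprSr ler_wpM2r ?(ltW n0)//.
  by rewrite lerXn2r ?nnegrE ?exprn_ge0// ler_weXn2l// ler1n.
have Nd : N%:R^-1 <= d%:R * 2 ^+ n * A.
  apply: (@le_trans _ _ A); first by rewrite lerDr.
  by rewrite ler_peMl ?addr_ge0// mulr_ege1// exprn_ege1// ler1n.
rewrite ler_pdivrMr ?mulr_gt0//.
have -> : 4 * d%:R * A / lam * (2 * 2 ^+ n * lam) = 8 * (d%:R * 2 ^+ n * A).
  by field; rewrite gt_eqF.
by lra.
Qed.

End comparison.

(** * The theorem *)

Theorem theorem2 (R : realType) (d : nat) (hd : (1 <= d)%N) (k gamma : R)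
    (hk : 0 < k) (hgamma0 : 0 < gamma)
    (hgamma : gamma < (d%:R + 1 + d%:R / k)^-1) :
  exists C : R, 0 < C /\
    forall (E : set 'rV[R]_d) (hE : closed E)
      (f : probability (Rd R d) R) (hf : prob_on E f)
      (N : nat) (hN : (1 <= N)%N)
      (G : probability (N.-tuple (Rd R d)) R) (hG : sym_prob_on E G)
      (j l : option nat) (hj : chaos_index N j) (hl : chaos_index N l)
      (hl1 : l <> Some 1%N),
    (Omega G f j <=
      C%:E * (moment_sum k f G) `^ (k^-1)
        * (Omega G f l + (N%:R^-1)%:E) `^ gamma)%E.
Proof.
have [C [C0 bound]] := optimal_scale hd hk hgamma0 hgamma.
exists C; split => // E _ f _ N N0 G symG j l hj hl hl1.
have Ni : 0 < N%:R^-1 :> R by rewrite invr_gt0 ltr0n.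
have := Omega_ge0 f G l; have := Omega_le1 f N0 symG hl.
case omE : (Omega G f l) => [om| |]//; rewrite !lee_fin => om1 om0.
have := Omega_ge0 f G j; have := Omega_le1 f N0 symG hj.
case omjE : (Omega G f j) => [x| |]//; rewrite !lee_fin => x1 x0.
have A0 : 0 < om + N%:R^-1 by rewrite ltr_wpDl.
rewrite -EFinD poweR_EFin.
have mom1 : (1 <= moment_sum k f G)%E.
  rewrite /moment_sum -[leLHS]adde0 leeD ?moment_ge1//.
  by rewrite (le_trans _ (moment_ge1 _ _)).
case momE : (moment_sum k f G) mom1 => [Mom| |]//.
  rewrite lee_fin => Mom1; rewrite poweR_EFin -!EFinM lee_fin.
  apply: bound => // L r lam r0 lam0.
  have := Omega_le_multiscale hd N0 hk symG L r0 lam0 hj hl hl1 omE momE.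
  by rewrite omjE lee_fin.
move=> _; rewrite poweRyr ?invr_eq0 ?gt_eqF//.
by rewrite gt0_muley ?lte_fin// gt0_mulye ?lte_fin ?powR_gt0// leey.
Qed.
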